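(* Let $(\Omega,m,\sigma,\mathcal{J}_0,T,\mathcal{B},\mathcal{L}_0,\nu_0,\varphi_0,H_\epsilon)$ be a random open system with a sequence of holes $H_{\omega,\epsilon_N}$, and assume that (C1'), (C2), (C3), (C4'), (C5'), (C7'), (C8) and (S) hold. Let $$\tau_{\omega,\mathcal{H}_{\omega,N}}(x):=\inf\{k\ge1:\ T_\omega^k(x)\in H_{\sigma^k\omega,\epsilon_N}\}$$ be the first random hitting time of the family of holes $\mathcal{H}_{\omega,N}=\{H_{\sigma^j\omega,\epsilon_N}\}_{j\ge0}$. Then for $m$-a.e. $\omega\in\Omega$ $$\lim_{N\to\infty}\mu_{\omega,0}\Bigl(\tau_{\omega,\mathcal{H}_{\omega,N}}\,\mu_{\omega,0}(H_{\omega,\epsilon_N})>t_\omega\Bigr)=\exp\left(-\int_\Omega t_\omega\theta_{\omega,0}\,dm(\omega)\right),$$ where $\theta_{\omega,0}=1-\sum_{k=0}^\infty\hat q^{(k)}_{\omega,0}$.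
   Context: Random open systems. $(\Omega,\mathscr{F},m)$ is a probability space and $\sigma:\Omega\to\Omega$ is an invertible, ergodic, $m$-preserving map. $X$ is a complete metrizable space with Borel $\sigma$-algebra $\mathscr{B}$; for each $\omega$, $\mathcal{J}_{\omega,0}\subseteq X$ is closed, $\omega\mapsto\mathcal{J}_{\omega,0}$ is a closed random set (i.e. measurable), and $T_\omega:\mathcal{J}_{\omega,0}\to\mathcal{J}_{\sigma\omega,0}$ is a map. Put $T_\omega^n=T_{\sigma^{n-1}\omega}\circ\cdots\circ T_\omega$, $\mathcal{J}_0=\bigcup_{\omega}\{\omega\}\times\mathcal{J}_{\omega,0}$ and $T(\omega,x)=(\sigma\omega,T_\omega(x))$ on $\mathcal{J}_0$. A random (probability) measure $\mu=\{\mu_\omega\}$ is a measure on $\Omega\times X$ with marginal $m$, identified with its disintegration into fibre (probability) measures $\mu_\omega$. $\{\mathcal{B}_\omega\}$ are Banach spaces of real-valued functions on $\mathcal{J}_{\omega,0}$, $g_{\omega,0}\in\mathcal{B}_\omega$ are weights, and $\mathcal{L}_{\omega,0}f(x)=\sum_{y\in T_\omega^{-1}(x)}f(y)g_{\omega,0}(y)$ is a well-defined operator $\mathcal{B}_\omega\to\mathcal{B}_{\sigma\omega}$. $\mathcal{B}$ is the space of $f:\mathcal{J}_0\to\mathbb{R}$ with $f_\omega\in\mathcal{B}_\omega$ for each $\omega$, and $(\mathcal{L}_0f)_\omega=\mathcal{L}_{\sigma^{-1}\omega,0}f_{\sigma^{-1}\omega}$. For a hole parameter $\epsilon$, $H_\epsilon\subseteq\mathcal{J}_0$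 is a measurable set with fibres $H_{\omega,\epsilon}\subseteq\mathcal{J}_{\omega,0}$; $\mathcal{J}_{\omega,\epsilon}=\mathcal{J}_{\omega,0}\setminus H_{\omega,\epsilon}$; $X_{\omega,N,\epsilon}=\{x\in\mathcal{J}_{\omega,0}:T_\omega^j(x)\notin H_{\sigma^j\omega,\epsilon},\ 0\le j\le N\}$; $X_{\omega,\infty,\epsilon}=\bigcap_{N\ge 0}X_{\omega,N,\epsilon}$; $\mathcal{L}_{\omega,\epsilon}(f)=\mathcal{L}_{\omega,0}(f\mathbf{1}_{\mathcal{J}_{\omega,\epsilon}})$. For operators, $A_\omega^n=A_{\sigma^{n-1}\omega}\circ\cdots\circ A_\omega$. The tuple is a random open system if: (M1) $T:\mathcal{J}_0\to\mathcal{J}_0$ is measurable for $\mathscr{F}\otimes\mathscr{B}$; (M2) for every measurable $h\in\mathcal{B}$ the map $(\omega,x)\mapsto(\mathcal{L}_0h)_\omega(x)$ is measurable; (CCM) there are a random probability measure $\nu_0=\{\nu_{\omega,0}\}$ on $\mathcal{J}_0$ and measurable $\lambda_0:\Omega\to\mathbb{R}\setminus\{0\}$, $\varphi_0:\mathcal{J}_0\to(0,\infty)$ with $\mathcal{L}_{\omega,0}(\varphi_{\omega,0})=\lambda_{\omega,0}\varphi_{\sigma\omega,0}$ and $\nu_{\sigma\omega,0}(\mathcal{L}_{\omega,0}(f))=\lambda_{\omega,0}\nu_{\omega,0}(f)$ for all $f\in\mathcal{B}_\omega$; the $\nu_{\omega,0}$ are non-atomic, $\lambda_{\omega,0}=\nu_{\sigma\omega,0}(\mathcal{L}_{\omega,0}\mathbf{1})$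 and $\log\lambda_{\omega,0}\in L^1(m)$; $\mu_{\omega,0}(f):=\int f\varphi_{\omega,0}\,d\nu_{\omega,0}$ defines a ($T$-invariant) random probability measure $\mu_0$; (B) $\mathcal{B}_\omega\subseteq L^\infty(\nu_{\omega,0})$ and there is a measurable $m$-a.e. finite $K:\Omega\to[1,\infty)$ with $\|f\|_{\infty,\omega}\le K_\omega\|f\|_{\mathcal{B}_\omega}$, where $\|\cdot\|_{\infty,\omega}$ is the $L^\infty(\nu_{\omega,0})$ norm; (A) the holes are decreasing: $H_{\epsilon'}\subseteq H_\epsilon$ for $0<\epsilon'\le\epsilon$; (X) for all sufficiently small $\epsilon>0$, $X_{\omega,\infty,\epsilon}\ne\emptyset$ for $m$-a.e. $\omega$. Here the holes form a decreasing sequence $H_{\omega,\epsilon_N}$, $N\in\mathbb{N}$; $\epsilon_N$ is merely an index, so in the conditions ''$\epsilon\ge0$'' ranges over $0$ and the $\epsilon_N$, and ''$\epsilon\to0$'' / ''small $\epsilon$'' mean $N\to\infty$ / large $N$. $\Omega_+=\{\omega:\mu_{\omega,0}(H_{\omega,\epsilon})>0\text{ for all }\epsilon>0\}$. For $\mu_{\omega,0}(H_{\omega,\epsilon})>0$, $k\ge0$, $$\hat q^{(k)}_{\omega,\epsilon}=\frac{\mu_{\sigma^{-(k+1)}\omega,0}\Bigl(T^{-(k+1)}_{\sigma^{-(k+1)}\omega}(H_{\omega,\epsilon})\cap\bigcap_{j=1}^kT^{-(k+1)+j}_{\sigma^{-(k+1)}\omega}(H^c_{\sigma^{-j}\omega,\epsilon})\cap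 H_{\sigma^{-(k+1)}\omega,\epsilon}\Bigr)}{\mu_{\sigma^{-(k+1)}\omega,0}\bigl(T^{-(k+1)}_{\sigma^{-(k+1)}\omega}(H_{\omega,\epsilon})\bigr)}.$$ Conditions: (S) There are $t\in L^\infty(m)$ with $t>0$, functions $\xi_N\in L^\infty(m)$ and $W<\infty$ with $\mu_{\omega,0}(H_{\omega,\epsilon_N})=(t_\omega+\xi_{\omega,N})/N$ for a.e. $\omega$ and each $N\ge1$, where $\lim_{N\to\infty}\xi_{\omega,N}=0$ for a.e. $\omega$ and $|\xi_{\omega,N}|\le W$ for a.e. $\omega$ and all $N\ge1$. (C1') There is $C_1\ge1$ with $C_1^{-1}\le\mathcal{L}_{\omega,0}\mathbf{1}\le C_1$ for $m$-a.e. $\omega$. (C2) For each $\epsilon\ge0$ there are a random measure $\{\nu_{\omega,\epsilon}\}$ supported in $\mathcal{J}_0$ and measurable $\lambda_\epsilon:\Omega\to(0,\infty)$ with $\log\lambda_{\omega,\epsilon}\in L^1(m)$ and $\varphi_\epsilon:\mathcal{J}_0\to\mathbb{R}$ with $\mathcal{L}_{\omega,\epsilon}(\varphi_{\omega,\epsilon})=\lambda_{\omega,\epsilon}\varphi_{\sigma\omega,\epsilon}$, $\nu_{\sigma\omega,\epsilon}(\mathcal{L}_{\omega,\epsilon}(f))=\lambda_{\omega,\epsilon}\nu_{\omega,\epsilon}(f)$ for all $f\in\mathcal{B}_\omega$, and, $m$-a.e., $\nu_{\omega,0}(\varphi_{\omega,\epsilon})=1$, $\nu_{\omega,0}(\mathbf{1})=1$.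 (C3) There are operators $Q_{\omega,\epsilon}:\mathcal{B}_\omega\to\mathcal{B}_{\sigma\omega}$ such that, for $m$-a.e. $\omega$ and all $f\in\mathcal{B}_\omega$, $\lambda_{\omega,\epsilon}^{-1}\mathcal{L}_{\omega,\epsilon}(f)=\nu_{\omega,\epsilon}(f)\varphi_{\sigma\omega,\epsilon}+Q_{\omega,\epsilon}(f)$, $Q_{\omega,\epsilon}(\varphi_{\omega,\epsilon})=0$, $\nu_{\sigma\omega,\epsilon}(Q_{\omega,\epsilon}(f))=0$. (C4') For each $f\in\mathcal{B}$ and $N\in\mathbb{N}$ there are $C_f>0$ and $\alpha(N)>0$ (independent of $\omega$) with $\sum_{N=1}^\infty\alpha(N)<\infty$ such that for $m$-a.e. $\omega$ and all $N$, $\sup_{\epsilon\ge0}\|Q^N_{\omega,\epsilon}f_\omega\|_{\infty,\sigma^N\omega}\le C_f\alpha(N)\|f_\omega\|_{\mathcal{B}_\omega}$. (C5') There is $C_2\ge1$ with $\sup_{\epsilon\ge0}\|\varphi_{\omega,\epsilon}\|_{\infty,\omega}\le C_2$ and $\|\varphi_{\omega,0}\|_{\mathcal{B}_\omega}\le C_2$ for $m$-a.e. $\omega$. (C7') There is $C_3\ge1$ such that for all sufficiently small $\epsilon>0$, $\operatorname{ess\,inf}_\omega\inf\varphi_{\omega,0}\ge C_3^{-1}>0$ and $\operatorname{ess\,inf}_\omega\inf\varphi_{\omega,\epsilon}\ge0$. (C8) For $m$-a.e. $\omega\in\Omega_+$ the limit $\hat q^{(k)}_{\omega,0}:=\lim_{\epsilon\to0}\hat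 q^{(k)}_{\omega,\epsilon}$ exists for each $k\ge0$.
   Formalization: The conformality identity for ν_0 in (CCM) is also assumed for f·1_{X_{ω,n,ε}} with f in B_ω, not only for f in B_ω, since otherwise the claim fails, e.g. for a non-ergodic mixture ν_0 on a countable shift with B the bounded functions of the first coordinate. *)

(* Defs.v *)
From HB Require Import structures.
From mathcomp Require Import all_boot all_order all_algebra.
From mathcomp Require Import all_classical all_reals all_analysis.
From mathcomp Require Import ess_sup_inf.

Set Implicit Arguments.
Unset Strict Implicit.
Unset Printing Implicit Defensive.

Import Order.TTheory GRing.Theory Num.Theory.
Import numFieldNormedType.Exports.

Local Open Scope classical_set_scope.
Local Open Scope ring_scope.

Notation borel X := (g_sigma_algebraType (@open X)).

(* Measurability of f : D -> T2 for the trace sigma-algebra on D.  Unlike with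
   [measurable_fun], D need not be measurable: the graph of a closed random
   set may fail to be product-measurable when X is not separable. *)
Definition trace_measurable_fun d1 d2 (T1 : measurableType d1)
    (T2 : measurableType d2) (D : set T1) (f : T1 -> T2) : Prop :=
  forall A, measurable A -> strace measurable D (D `&` f @^-1` A).

(* Sum of a family of reals over an arbitrary set, meaningful when the family
   is summable. *)
Definition rsum (R : realType) (X : choiceType) (D : set X) (a : X -> R) : R :=
  fine (\esum_(y in D) (Num.max (a y) 0)%:E)
  - fine (\esum_(y in D) (Num.max (- a y) 0)%:E).

(* No atom: every set of positive measure splits. *)
Definition non_atomic d (T : measurableType d) (R : realType)
    (mu : {measure set T -> \bar R}) : Prop :=
  forall A, measurable A -> (0 < mu A)%E ->
  exists B, [/\ measurable B, B `<=` A, (0 < mu B)%E & (mu B < mu A)%E].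

Definition ergodic d (T : measurableType d) (R : realType)
    (m : probability T R) (s : T -> T) : Prop :=
  forall A, measurable A -> s @^-1` A = A -> m A = 0%E \/ m A = 1%E.

(* A Banach space of real-valued functions on D.  Functions on D are encoded
   as functions on X that vanish off D, so that equality of functions on D is
   equality of their encodings. *)
Record banach_fun_space (R : realType) (X : Type) (D : set X) := BanachFunSpace {
  bfs_sort :> completeNormedModType R ;
  ev : bfs_sort -> X -> R ;
  ev_linear : forall (a : R) (f g : bfs_sort) x,
    ev (a *: f + g) x = a * ev f x + ev g x ;
  ev_off : forall f x, ~ D x -> ev f x = 0 ;
  ev_inj : forall f g, (forall x, D x -> ev f x = ev g x) -> f = g }.

(* Families indexed by e : nat use 0 for the closed system (epsilon = 0) and
   N >= 1 for the hole parameter epsilon_N. *)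
Record system_data d (Omega : measurableType d) (R : realType)
    (X : completePseudoMetricType R) := SystemData {
  sd_sig : Omega -> Omega ;
  sd_sigV : Omega -> Omega ;
  sd_J : Omega -> set X ;
  sd_T : Omega -> X -> X ;
  sd_B : forall w, banach_fun_space R (sd_J w) ;
  sd_g : forall w, sd_B w ;
  sd_L : nat -> forall w, {linear sd_B w -> sd_B (sd_sig w)} ;
  sd_H : nat -> set (Omega * borel X) ;
  sd_nu : nat -> R.-ker Omega ~> borel X ;
  sd_lam : nat -> Omega -> R ;
  sd_phi : nat -> forall w, sd_B w ;
  sd_Q : nat -> forall w, {linear sd_B w -> sd_B (sd_sig w)} }.

Section RandomOpenSystem.
Context d (Omega : measurableType d) (R : realType).
Variables (m : probability Omega R) (X : completePseudoMetricType R).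
Variable S : system_data Omega X.

Local Notation sig := (sd_sig S).
Local Notation sigV := (sd_sigV S).
Local Notation J := (sd_J S).
Local Notation T := (sd_T S).
Local Notation B := (sd_B S).
Local Notation g := (sd_g S).
Local Notation L := (sd_L S).
Local Notation H := (sd_H S).
Local Notation nu := (sd_nu S).
Local Notation lam := (sd_lam S).
Local Notation phi := (sd_phi S).
Local Notation Q := (sd_Q S).

Definition J0 : set (Omega * borel X) := [set z | J z.1 z.2].

Definition skew (z : Omega * borel X) : Omega * borel X :=
  (sig z.1, T z.1 z.2).

Fixpoint Titer (n : nat) (w : Omega) (x : X) : X :=
  if n is k.+1 then T (iter k sig w) (Titer k w x) else x.

Definition transfer (w : Omega) (f : X -> R) (x : X) : R :=
  rsum [set y | J w y /\ T w y = x] (fun y => f y * ev (g w) y).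

Definition hole (e : nat) (w : Omega) : set X :=
  [set x | (0 < e)%N /\ H e (w, x)].

Definition Jeps (e : nat) (w : Omega) : set X := J w `\` hole e w.

Definition Xsurv (n e : nat) (w : Omega) : set X :=
  [set x | J w x /\
    forall j, (j <= n)%N -> ~ hole e (iter j sig w) (Titer j w x)].

Definition Xinf (e : nat) (w : Omega) : set X := \bigcap_n Xsurv n e w.

(* nu_{w,e}(f); for f a function on J_w extended by zero. *)
Definition nuint (e : nat) (w : Omega) (f : X -> R) : R :=
  \int[nu e w]_x f x.

Definition supnorm (w : Omega) (f : B w) : \bar R :=
  'N[nu 0 w]_+oo[EFin \o (ev f : borel X -> R)].

Definition mu0 (w : Omega) (A : set X) : \bar R :=
  (\int[nu 0 w]_(x in (A : set (borel X))) (ev (phi 0 w) x)%:E)%E.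

Fixpoint Qiter (e n : nat) (w : Omega) : B w -> B (iter n sig w) :=
  match n return B w -> B (iter n sig w) with
  | 0%N => id
  | k.+1 => fun f => Q e (iter k sig w) (Qiter e k f)
  end.

Record random_open_system : Prop := {
  ros_sigK : cancel sig sigV ;
  ros_sigVK : cancel sigV sig ;
  ros_sig_meas : measurable_fun setT sig ;
  ros_sigV_meas : measurable_fun setT sigV ;
  ros_preserving : forall A, measurable A -> m (sig @^-1` A) = m A ;
  ros_ergodic : ergodic m sig ;
  ros_J_closed : forall w, closed (J w) ;
  ros_J_random : forall U : set X, open U ->
    measurable [set w | J w `&` U !=set0] ;
  ros_T_maps : forall w x, J w x -> J (sig w) (T w x) ;
  ros_summable : forall w (f : B w) x,
    summable [set y | J w y /\ T w y = x] (fun y => (ev f y * ev (g w) y)%:E) ;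
  ros_L : forall e w (f : B w) x,
    ev (L e w f) x = transfer w (fun y => ev f y * \1_(Jeps e w) y) x ;
  ros_H_meas : forall N, (0 < N)%N -> strace measurable J0 (H N) ;
  ros_M1 : trace_measurable_fun J0 skew ;
  ros_M2 : forall h : forall w, B w,
    trace_measurable_fun J0 (fun z => ev (h z.1) z.2) ->
    trace_measurable_fun J0
      (fun z => ev (L 0 (sigV z.1) (h (sigV z.1))) z.2) ;
  ros_nu_prob : \forall w \ae m, nu 0 w setT = 1%E ;
  ros_nu_supp : \forall w \ae m, nu 0 w (~` J w) = 0%E ;
  ros_nu_nonatomic : \forall w \ae m, non_atomic (nu 0 w) ;
  ros_lam_meas : measurable_fun setT (lam 0) ;
  ros_lam_neq0 : forall w, lam 0 w != 0 ;
  ros_phi_meas : trace_measurable_fun J0 (fun z => ev (phi 0 z.1) z.2) ;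
  ros_phi_gt0 : forall w x, J w x -> 0 < ev (phi 0 w) x ;
  ros_phi_eigen : \forall w \ae m, L 0 w (phi 0 w) = lam 0 w *: phi 0 (sig w) ;
  ros_conformal : \forall w \ae m, forall f : B w,
    nuint 0 (sig w) (ev (L 0 w f)) = lam 0 w * nuint 0 w (ev f) ;
  (* Conformality also for the restrictions of f to survivor sets, as is
     implicit in L_{w,e}(f) = L_{w,0}(f 1_{J_{w,e}}) and in
     L^n_{w,e}(f) = L^n_{w,0}(f 1_{X_{w,n-1,e}}); the space B_w is not required
     to be closed under multiplication by these indicators. *)
  ros_conformal_surv : \forall w \ae m, forall (f : B w) (n e : nat),
    nuint 0 (sig w) (transfer w (fun y => ev f y * \1_(Xsurv n e w) y))
    = lam 0 w * nuint 0 w (fun y => ev f y * \1_(Xsurv n e w) y) ;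
  ros_one : forall w, exists one : B w, forall x, J w x -> ev one x = 1 ;
  ros_lam_def : \forall w \ae m,
    lam 0 w = nuint 0 (sig w) (transfer w \1_(J w)) ;
  ros_loglam : m.-integrable setT (EFin \o (fun w => ln (lam 0 w))) ;
  ros_mu_prob : \forall w \ae m, mu0 w setT = 1%E ;
  ros_mu_inv : \forall w \ae m, forall A : set (borel X), measurable A ->
    mu0 w (J w `&` T w @^-1` A) = mu0 (sig w) A ;
  ros_B_meas : forall w (f : B w),
    measurable_fun setT (ev f : borel X -> R) ;
  ros_B_bound : exists K : Omega -> R, [/\ measurable_fun setT K,
    forall w, 1 <= K w &
    \forall w \ae m, forall f : B w, (supnorm f <= (K w * `|f|)%:E)%E] ;
  ros_A : forall M N, (0 < M)%N -> (M <= N)%N -> H N `<=` H M ;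
  ros_X : \forall N \near \oo, \forall w \ae m, Xinf N w !=set0 }.

Definition OmegaPlus : set Omega :=
  [set w | forall N, (0 < N)%N -> (0 < mu0 w (hole N w))%E].

Definition qhat (N k : nat) (w : Omega) : R :=
  let w' := iter k.+1 sigV w in
  let hit := [set x | J w' x /\ hole N w (Titer k.+1 w' x)] in
  fine (mu0 w' (hit `&`
    [set x | forall j, (1 <= j <= k)%N ->
       ~ hole N (iter j sigV w) (Titer (k.+1 - j) w' x)] `&` hole N w'))
  / fine (mu0 w' hit).

Definition qhat0 (k : nat) (w : Omega) : R := limn (fun N => qhat N k w).

Definition theta (w : Omega) : R := 1 - limn (series (fun k => qhat0 k w)).

(* The infimum of the empty set is +oo. *)
Definition hitting_time (N : nat) (w : Omega) (x : X) : \bar R :=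
  ereal_inf [set (k%:R)%:E | k in
    [set k : nat | (1 <= k)%N /\ hole N (iter k sig w) (Titer k w x)]].

Definition cond_S (t : Omega -> R) : Prop :=
  [/\ t \in Lfun m +oo%E, \forall w \ae m, 0 < t w &
  exists (xi : nat -> Omega -> R) (W : R),
  [/\ forall N, (0 < N)%N -> xi N \in Lfun m +oo%E,
      \forall w \ae m, forall N, (0 < N)%N ->
        mu0 w (hole N w) = ((t w + xi N w) / N%:R)%:E,
      \forall w \ae m, xi N w @[N --> \oo] --> (0 : R) &
      \forall w \ae m, forall N, (0 < N)%N -> `|xi N w| <= W]].

Definition cond_C1' : Prop :=
  exists2 C1 : R, 1 <= C1 & \forall w \ae m, forall x, J (sig w) x ->
    C1^-1 <= transfer w \1_(J w) x <= C1.

Record cond_C2 : Prop := {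
  C2_supp : forall e, \forall w \ae m, nu e w (~` J w) = 0%E ;
  C2_integrable : forall e, \forall w \ae m, forall f : B w,
    (nu e w).-integrable setT (EFin \o (ev f : borel X -> R)) ;
  C2_lam_meas : forall e, measurable_fun setT (lam e) ;
  C2_lam_gt0 : forall e w, 0 < lam e w ;
  C2_loglam : forall e,
    m.-integrable setT (EFin \o (fun w => ln (lam e w))) ;
  C2_phi_meas : forall e,
    trace_measurable_fun J0 (fun z => ev (phi e z.1) z.2) ;
  C2_eigen : forall e, \forall w \ae m,
    L e w (phi e w) = lam e w *: phi e (sig w) ;
  C2_conformal : forall e, \forall w \ae m, forall f : B w,
    nuint e (sig w) (ev (L e w f)) = lam e w * nuint e w (ev f) ;
  C2_norm : forall e, \forall w \ae m, nuint 0 w (ev (phi e w)) = 1 ;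
  C2_one : \forall w \ae m, nuint 0 w \1_(J w) = 1 }.

Definition cond_C3 : Prop :=
  forall e, \forall w \ae m, forall f : B w,
  [/\ (lam e w)^-1 *: L e w f = nuint e w (ev f) *: phi e (sig w) + Q e w f,
      Q e w (phi e w) = 0 &
      nuint e (sig w) (ev (Q e w f)) = 0].

Definition cond_C4' : Prop :=
  forall f : forall w, B w, exists (C : R) (alpha : nat -> R),
  [/\ 0 < C, forall N, (1 <= N)%N -> 0 < alpha N,
      cvgn (series (fun N => alpha N.+1)) &
      \forall w \ae m, forall N, (1 <= N)%N -> forall e,
        (supnorm (Qiter e N (f w)) <= (C * alpha N * `|f w|)%:E)%E].

Definition cond_C5' : Prop :=
  exists2 C2 : R, 1 <= C2 & \forall w \ae m,
    (forall e, (supnorm (phi e w) <= C2%:E)%E) /\ `|phi 0 w| <= C2.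

Definition ess_inf_phi (e : nat) : \bar R :=
  ess_inf m (fun w => ereal_inf [set (ev (phi e w) x)%:E | x in J w]).

Definition cond_C7' : Prop :=
  exists2 C3 : R, 1 <= C3 & \forall N \near \oo,
    (C3^-1%:E <= ess_inf_phi 0)%E /\ (0 <= ess_inf_phi N)%E.

Definition cond_C8 : Prop :=
  \forall w \ae m, OmegaPlus w -> forall k, cvgn (fun N => qhat N k w).

End RandomOpenSystem.

(* Main.v *)
(* Conformality on survivor sets and the decomposition of the transfer operators
   give, with lam^n the product of lam along the orbit and Q^n the iterate of Q,
     mu_w(X_{w,n-1,e}) =
       (lam_e^n / lam_0^n) (nu_{w,e}(phi_0) + nu_0(Q_e^n phi_0)),
   and lam_e / lam_0 = 1 - a_e, where a_e(w) = nu_{w,0}(phi_e 1_{H_{w,e}}) is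
   the escape rate.  Since sum alpha(n) < oo, the survival probability up to
   time n is asymptotic to the product of the 1 - a_e(s^i w), i < n, with
   a_e = O(1/N).

   The points of the fibre over s^{-n} w which first enter a hole at time n have
   measure mu_w(H_{w,e}) (1 - sum_{k<n} qhat_e^(k)), by T-invariance and
   splitting according to the previous visit; comparing with the formula above
   yields a_e / mu_w(H_{w,e}) -> theta_w, hence N a_{e_N} -> t theta a.e.  The
   averages of N a_{e_N} along an orbit then tend to the integral of t theta by
   Maker's extension of Birkhoff's theorem, so the survival probabilities up to
   a time equivalent to N tend to exp (- int t theta).  Finally, tau mu_w(H) > t
   says that the orbit of T x survives up to such a time. *)
Require Import Defs.
From HB Require Import structures.
From mathcomp Require Import all_boot all_order all_algebra.
From mathcomp Require Import all_classical all_reals all_analysis.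
From mathcomp Require Import ess_sup_inf.
From mathcomp Require Import measurable_realfun ring lra zify.
Import Order.TTheory GRing.Theory Num.Theory.
Import numFieldNormedType.Exports.
Local Open Scope classical_set_scope.
Local Open Scope ring_scope.

Set Implicit Arguments.
Unset Strict Implicit.
Unset Printing Implicit Defensive.

(** * Integrals of functions not known to be measurable *)

Section integral_of_nonmeasurable_functions.
Local Open Scope ereal_scope.
Context d (T : measurableType d) (R : realType).
Variable mu : {measure set T -> \bar R}.
Import HBNNSimple.

(* No measurability is needed: multiplying a simple minorant by the indicator
   of the complement of a null set does not change its integral. *)
Lemma ge0_ae_le_integral_nonmeasurable (f g : T -> \bar R) :
  (forall x, 0 <= f x) -> (forall x, 0 <= g x) ->
  (\forall x \ae mu, f x <= g x) -> \int[mu]_x f x <= \int[mu]_x g x.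
Proof.
move=> f0 g0 [N [mN N0 fgN]].
rewrite !ge0_integralTE//; apply: ge_ereal_sup => _ [h /= hf <-].
have mNC : measurable (~` N) by exact: measurableC.
apply: ereal_sup_ubound; exists (proj_nnsfun h mNC) => /= [x|].
  rewrite -[X in X%:E]/(proj_nnsfun h mNC x) -mrestrict /patch.
  case: ifPn => [|_ //]; rewrite inE => xN; apply: (le_trans (hf x)).
  by apply: contrapT => fgx; exact/xN/fgN.
rewrite -!integralT_nnsfun; apply: ge0_ae_eq_integral => //.
- exact/measurable_EFinP.
- exact/measurable_EFinP.
- by move=> x _; rewrite lee_fin fun_ge0.
- by move=> x _; rewrite lee_fin fun_ge0.
exists N; split => // x /= xN; apply: contrapT => Nx; apply: xN => _.
by rewrite mindicE mem_set// mulr1.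
Qed.

(** This allows a limit function such as [t * theta], of unknown measurability, to be replaced under
    the integral by a measurable version. *)
Lemma ae_eq_integral_nonmeasurable (f g : T -> \bar R) :
  (\forall x \ae mu, f x = g x) -> \int[mu]_x f x = \int[mu]_x g x.
Proof.
move=> fg; rewrite integralE [RHS]integralE; congr (_ - _);
  apply/eqP; rewrite eq_le; apply/andP; split;
  apply: ge0_ae_le_integral_nonmeasurable => //; apply: filterS fg => x fgx;
  by rewrite ?funeposE ?funenegE fgx.
Qed.

End integral_of_nonmeasurable_functions.

(** * Elementary estimates and limits for real sequences *)

Lemma exists_natr_ge (R : realType) (x : R) : exists k : nat, x <= k%:R.
Proof. by exists (Num.truncn x).+1; exact/ltW/truncnS_gt. Qed.

Lemma cvg_invn (R : realType) : (n%:R^-1 : R) @[n --> \oo] --> 0.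
Proof.
by rewrite -(cvg_shiftS (fun n => n%:R^-1 : R)); exact: cvg_harmonic.
Qed.

(** Factors are exchanged one at a time: all of them lie in [0, 1], so the errors add up, and for 0
    <= z <= 1 a single exchange costs expR (- z) - (1 - z) <= z ^ 2. *)
Lemma prod_1B_expR (R : realType) n (a : nat -> R) :
  (forall i, (i < n)%N -> 0 <= a i <= 1) ->
  `|\prod_(i < n) (1 - a i) - expR (- \sum_(i < n) a i)| <=
    \sum_(i < n) a i ^+ 2.
Proof.
elim: n => [|n IH] a01; first by rewrite !big_ord0 oppr0 expR0 subrr normr0.
rewrite !big_ord_recr /= opprD expRD.
have {IH} := IH (fun i ni => a01 i (ltnW ni)).
set p := \prod_(i < n) _; set x := expR (- \sum_(i < n) _).
set y := expR _; set s := \sum_(i < n) _ => pxs.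
have /andP[an0 an1] := a01 n (ltnSn n).
have x01 : 0 <= x <= 1.
  rewrite expR_ge0 -expR0 ler_expR oppr_le0 /=; apply: sumr_ge0 => i _.
  by case/andP: (a01 i (ltnW (ltn_ord i))).
have yge : 1 - a n <= y by exact: expR_ge1Dx.
(* With z = [a n], expR z >= 1 + z gives y <= 1 / (1 + z) <= 1 - z + z ^ 2. *)
have yle : y - (1 - a n) <= a n ^+ 2.
  have e1 : 1 + a n <= expR (a n) by exact: expR_ge1Dx.
  have yE : y * expR (a n) = 1 by rewrite /y -expRD addNr expR0.
  have y0 : 0 < y by exact: expR_gt0.
  have : y * (1 + a n) <= 1.
    by rewrite -[leRHS]yE ler_wpM2l// ltW.
  move: (a n) (y) an0 => z t z0 tz.
  have z1 : 0 < 1 + z by lra.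
  rewrite -(ler_pM2r z1) expr2.
  have z3 : 0 <= z * (z * z) by rewrite !mulr_ge0.
  by lra.
have -> : p * (1 - a n) - x * y = (p - x) * (1 - a n) - x * (y - (1 - a n)).
  by ring.
apply: le_trans (ler_normB _ _) _; rewrite !normrM; apply: lerD.
  by apply: le_trans pxs; rewrite ler_piMr// ger0_norm; lra.
rewrite !ger0_norm; [|lra..].
by case/andP: x01 => x0 x1; apply: le_trans yle; rewrite ler_piMl// subr_ge0.
Qed.

Lemma cvg_le_norm (R : realType) (u v : nat -> R) : v @ \oo --> 0 ->
  (\forall n \near \oo, `|u n| <= v n) -> u @ \oo --> 0.
Proof.
move=> v0 uv; apply/norm_cvg0P; apply: (squeeze_cvgr _ (cvg_cst 0) v0).
by apply: filterS uv => n ->; rewrite normr_ge0.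
Qed.

(* An interchange of the limits in n and N, licensed by an error [beta n]
   uniform in N. *)
Lemma cvg_truncated_series (R : realType) (b : nat -> R) (p q : nat -> nat -> R)
    (beta : nat -> R) (K M : R) :
  (forall n, p n N @[N --> \oo] --> (1 : R)) ->
  (forall k, cvgn (fun N => q N k)) ->
  (\forall N \near \oo, forall n,
    `|p n N * b N - (1 - \sum_(k < n.+1) q N k)| <= beta n * K) ->
  (\forall N \near \oo, `|b N| <= M) ->
  (\forall N \near \oo, forall k, 0 <= q N k) ->
  (\forall N \near \oo, forall n, \sum_(k < n) q N k <= 1) ->
  beta @ \oo --> 0 ->
  b @ \oo --> 1 - limn (series (fun k => limn (fun N => q N k))).
Proof.
move=> p1 cq pb bM q0 q1 beta0; set ql := fun k => limn _.
have sumq n : \sum_(k < n) q N k @[N --> \oo] --> \sum_(k < n) ql k.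
  elim: n => [|n IH].
    by rewrite big_ord0; under eq_fun do rewrite big_ord0; exact: cvg_cst.
  rewrite big_ord_recr; under eq_fun do rewrite big_ord_recr.
  by apply: cvgD => //; exact: cq.
have seriesE n : series ql n = \sum_(k < n) ql k by rewrite /series /= big_mkord.
have ql0 k : 0 <= ql k.
  by apply: (cvgr_to_ge (cq k)); apply: filterS q0 => N; exact.
have ql1 n : series ql n <= 1.
  by rewrite seriesE; apply: (cvgr_to_le (sumq n)); apply: filterS q1 => N; exact.
have cs : cvgn (series ql).
  apply: nondecreasing_is_cvgn; last by exists 1 => _ [n _ <-].
  by apply/nondecreasing_seqP => n; rewrite !seriesE big_ord_recr /= lerDl.
set s := limn (series ql).
apply/cvgrPdist_le => e e0; have e4 : 0 < e / 4 by rewrite divr_gt0.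
have bK : beta n * K @[n --> \oo] --> 0.
  by rewrite -(mul0r K); apply: cvgMl.
have /cvgrPdist_le/(_ _ e4)[n1 _ Hn1] := bK.
have /cvgrPdist_le/(_ _ e4)[n2 _ Hn2] := cs.
(* The error e is split in four: [beta n * K] and the tail of the series are controlled by this n;
   then N is taken large for the defect of [p n N] from 1 and for the finite sum. *)
pose n := maxn n1 n2.
have bn : `|beta n * K| <= e / 4.
  by have := Hn1 n (leq_maxl _ _); rewrite sub0r normrN.
have sn : `|s - series ql n.+1| <= e / 4 by apply: Hn2; rewrite /= leqW// leq_maxr.
have pM : (1 - p n N) * M @[N --> \oo] --> 0.
  rewrite -(mul0r M); apply: cvgMl; rewrite -(subrr 1).
  by apply: cvgB; [exact: cvg_cst|exact: p1].
near=> N.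
have h0 : forall n, `|p n N * b N - (1 - \sum_(k < n.+1) q N k)| <= beta n * K.
  by near: N.
have {h0} h1 := h0 n.
have h2 : `|b N| <= M by near: N.
have h3 : `|0 - (1 - p n N) * M| <= e / 4.
  by near: N; move/cvgrPdist_le : pM; exact.
have h4 : `|\sum_(k < n.+1) ql k - \sum_(k < n.+1) q N k| <= e / 4.
  by near: N; move/cvgrPdist_le : (sumq n.+1); exact.
have h5 : `|(1 - p n N) * b N| <= e / 4.
  have M0 : 0 <= M by exact: le_trans h2.
  apply: le_trans h3; rewrite sub0r normrN !normrM ler_wpM2l//.
  by rewrite (ger0_norm M0).
rewrite seriesE in sn.
have {}h1 := le_trans h1 (ler_norm _).
have {}h1 := le_trans h1 bn.
rewrite !ler_norml in h1 h4 h5 sn *.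
by lra.
Unshelve. all: by end_near. Qed.

Lemma cvg_prod1 (R : realType) (f : nat -> nat -> R) n :
  (forall i, f i N @[N --> \oo] --> (1 : R)) ->
  \prod_(i < n) f i N @[N --> \oo] --> (1 : R).
Proof.
move=> f1; elim: n => [|n IH].
  by under eq_fun do rewrite big_ord0; exact: cvg_cst.
have H : \prod_(i < n) f i N * f n N @[N --> \oo] --> (1 * 1 : R) by exact: cvgM.
rewrite mulr1 in H; apply: cvg_trans H; apply: near_eq_cvg; apply: nearW => N.
by rewrite big_ord_recr.
Qed.

(** * Birkhoff averages *)

Section ergodic_theorem.
Context d (T : measurableType d) (R : realType).
Variables (m : probability T R) (s : T -> T).
Hypothesis ms : measurable_fun setT s.
Hypothesis s_preserving : forall A, measurable A -> m (s @^-1` A) = m A.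
Hypothesis s_ergodic : ergodic m s.

Lemma ae_preserving (P : T -> Prop) :
  (\forall x \ae m, P x) -> \forall x \ae m, P (s x).
Proof.
move=> [N [mN N0 PN]]; exists (s @^-1` N); split.
- by rewrite -[X in measurable X]setTI; exact: ms.
- by rewrite s_preserving.
- by move=> x /= nP; apply: PN.
Qed.

Lemma ae_iter_preserving (P : T -> Prop) :
  (\forall x \ae m, P x) -> \forall x \ae m, forall n, P (iter n s x).
Proof.
move=> Px; apply/ae_foralln => n.
elim: n P Px => [//|n IH] P Px /=.
exact: (IH (fun x => P (s x)) (ae_preserving Px)).
Qed.

Lemma bounded_prob_integrable (f : T -> R) (B : R) : measurable_fun setT f ->
  (forall x, `|f x| <= B) -> m.-integrable setT (EFin \o f).
Proof.
move=> mf fB; apply: measurable_bounded_integrable => //.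
  exact: le_lt_trans (probability_le1 m measurableT) (ltry 1).
exists B; split => [|M BM x _ /=]; first exact: num_real.
exact: le_trans (fB x) (ltW BM).
Qed.

Lemma bounded_cvg_Rintegral (f_ : nat -> T -> R) (f : T -> R) (B : R) :
  (forall n, measurable_fun setT (f_ n)) -> measurable_fun setT f ->
  (forall n x, `|f_ n x| <= B) ->
  (\forall x \ae m, f_ ^~ x @ \oo --> f x) ->
  m.-integrable setT (EFin \o f) /\
  \int[m]_x f_ n x @[n --> \oo] --> \int[m]_x f x.
Proof.
move=> mf_ mf fB f_f.
have [|||||iF _] := @dominated_convergence _ _ _ m setT measurableT
    (fun n => EFin \o f_ n) (EFin \o f) (EFin \o cst B).
- by move=> n; exact/measurable_EFinP.
- exact/measurable_EFinP.
- by apply: filterS f_f => x fx _; apply: cvg_EFin => //; exact: nearW.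
- by apply: (@bounded_prob_integrable _ `|B|).
- by apply: nearW => x n _ /=; rewrite lee_fin.
move=> If; split => //.
rewrite /Rintegral; move: If; rewrite -(fineK (integrable_fin_num measurableT iF)).
exact: fine_cvg.
Qed.

Lemma Rintegral_preserving (f : T -> R) (B : R) : measurable_fun setT f ->
  (forall x, `|f x| <= B) -> \int[m]_x f (s x) = \int[m]_x f x.
Proof.
move=> mf fB; rewrite /Rintegral; congr fine.
have := @integral_pushforward _ _ T T R s ms m setT (EFin \o f).
rewrite preimage_setT /= => <- //.
- by apply: eq_measure_integral => A mA _; exact: s_preserving.
- exact/measurable_EFinP.
- apply: (@bounded_prob_integrable (f \o s) B) => [|x]; last exact: fB.
  exact: measurableT_comp.
Qed.

Definition birkhoff_sum (g : T -> R) n x := \sum_(i < n) g (iter i s x).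

Lemma birkhoff_sumSl g n x :
  birkhoff_sum g n.+1 x = g x + birkhoff_sum g n (s x).
Proof.
rewrite /birkhoff_sum big_ord_recl; congr (_ + _).
by apply: eq_bigr => i _; rewrite lift0 iterSr.
Qed.

Lemma measurable_iter n : measurable_fun setT (iter n s).
Proof. by elim: n => [|n IH]; [exact: measurable_id|exact: measurableT_comp]. Qed.

Lemma measurable_birkhoff_sum g n : measurable_fun setT g ->
  measurable_fun setT (birkhoff_sum g n).
Proof.
move=> mg; apply: measurable_sum => i.
by apply: measurableT_comp => //; exact: measurable_iter.
Qed.

Let unbounded g := [set x | forall K : nat, exists n, K%:R < birkhoff_sum g n x].

(** The sums at x and at s x differ by the single term g x, absorbed by a shift of K. The invariance
    is exact, as [ergodic] requires. *)
Let unbounded_invariant g : s @^-1` (unbounded g) = unbounded g.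
Proof.
apply/seteqP; split => x /= ux K.
  have [k gk] := exists_natr_ge (- g x).
  have [n Kn] := ux (K + k)%N; exists n.+1.
  by rewrite birkhoff_sumSl; move: Kn; rewrite natrD; lra.
have [k gk] := exists_natr_ge (g x).
have [[|n]] := ux (K + k)%N.
  by rewrite /birkhoff_sum big_ord0 ltrn0.
by rewrite birkhoff_sumSl natrD => Kn; exists n; lra.
Qed.

Let measurable_unbounded g : measurable_fun setT g -> measurable (unbounded g).
Proof.
move=> mg.
have -> : unbounded g =
    \bigcap_K \bigcup_n (birkhoff_sum g n @^-1` `]K%:R, +oo[).
  apply/seteqP; split => x /= ux K.
    by move=> _; have [n Kn] := ux K; exists n => //=; rewrite in_itv /= Kn.
  by have [//|n _ /=] := ux K; rewrite in_itv /= andbT => Kn; exists n.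
apply: bigcapT_measurable => K; apply: bigcupT_measurable => n.
by rewrite -[X in measurable X]setTI; exact: measurable_birkhoff_sum.
Qed.

Let maxsum g := fix F n x :=
  if n is k.+1 then Num.max 0 (g x + F k (s x)) else 0 : R.

Let maxsum_ge0 g n x : 0 <= maxsum g n x.
Proof. by case: n => //= n; rewrite le_max lexx. Qed.

Let maxsumS g n x : maxsum g n x <= maxsum g n.+1 x.
Proof.
elim: n x => [|n IH] x; first exact: maxsum_ge0.
rewrite [leLHS]/= [leRHS]/=.
by rewrite ge_max le_max lexx/= le_max; apply/orP; right; rewrite lerD2l IH.
Qed.

Let maxsum_homo g x : {homo (maxsum g)^~ x : n k / (n <= k)%N >-> n <= k}.
Proof. by apply: homo_leq => [//|n k l|n]; [exact: le_trans|exact: maxsumS]. Qed.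

Let maxsum_ge g n x : birkhoff_sum g n x <= maxsum g n x.
Proof.
elim: n x => [|n IH] x; first by rewrite /birkhoff_sum big_ord0.
by rewrite birkhoff_sumSl /= le_max lerD2l IH orbT.
Qed.

Let maxsum_le g (B : R) n x :
  (forall x, `|g x| <= B) -> maxsum g n x <= n%:R * B.
Proof.
move=> gB; have B0 : 0 <= B by exact: le_trans (gB point).
elim: n x => [|n IH] x /=; first by rewrite mul0r.
rewrite ge_max mulr_ge0//= -natr1 mulrDl mul1r addrC lerD//.
by rewrite (le_trans _ (gB x))// ler_norm.
Qed.

Let measurable_maxsum g n : measurable_fun setT g ->
  measurable_fun setT (maxsum g n).
Proof.
move=> mg; elim: n => [|n IH]; first exact: measurable_cst.
apply: (@measurable_maxr _ _ _ _ (cst 0) (fun x => g x + maxsum g n (s x))) => //.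
by apply: measurable_funD => //; exact: measurableT_comp.
Qed.

(* [maxsum g n] is the maximum M_n of the first n + 1 Birkhoff sums.  If these
   are unbounded a.e., then M_{n+1} - M_n \o s = max (- M_n \o s, g) tends to
   g, while its integral is that of M_{n+1} - M_n >= 0. *)
Lemma birkhoff_sum_bounded (g : T -> R) (B : R) : measurable_fun setT g ->
  (forall x, `|g x| <= B) -> \int[m]_x g x < 0 ->
  \forall x \ae m, exists K : nat, forall n, birkhoff_sum g n x <= K%:R.
Proof.
move=> mg gB gneg; have B0 : 0 <= B by exact: le_trans (gB point).
suff u0 : m (unbounded g) = 0%E.
  exists (unbounded g); split => //; first exact: measurable_unbounded.
  move=> x /= nb K; apply: contrapT => bnd; apply: nb; exists K => n.
  by rewrite leNgt; apply/negP => Kn; apply: bnd; exists n.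
have [//|u1] := s_ergodic (measurable_unbounded mg) (unbounded_invariant g).
exfalso; move: gneg; apply/negP; rewrite -leNgt.
have aeu : \forall x \ae m, unbounded g x.
  exists (~` unbounded g); split => //.
    by apply: measurableC; exact: measurable_unbounded.
  rewrite probability_setC; last exact: measurable_unbounded.
  by rewrite u1 subee.
pose D n x := maxsum g n.+1 x - maxsum g n (s x).
have DE n x : D n x = Num.max (- maxsum g n (s x)) (g x).
  by rewrite /D /= addr_maxl add0r addrK.
have mD n : measurable_fun setT (D n).
  apply: measurable_funB; first exact: measurable_maxsum.
  by apply: measurableT_comp => //; exact: measurable_maxsum.
have DB n x : `|D n x| <= B.
  have := gB x; have := maxsum_ge0 g n (s x); rewrite DE !ler_norml.
  by move=> M0 /andP[g1 g2]; rewrite le_max g1 orbT/= ge_max g2 andbT; lra.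
have Dg : \int[m]_x D n x @[n --> \oo] --> \int[m]_x g x.
  apply: (@bounded_cvg_Rintegral _ _ B _ _ _ _).2 => //.
  have := ae_preserving aeu; apply: filterS => x ux.
  (* Once some Birkhoff sum at s x exceeds - g x, the maximum in [DE] equals g x for all later n, so
     the sequence is eventually constant. *)
  have [k gk] := exists_natr_ge (- g x).
  have [n0 kn0] := ux k.
  apply: cvg_near_cst; exists n0 => // n /= n0n; rewrite DE; apply/max_idPr.
  have := maxsum_homo g (s x) n0n; have := maxsum_ge g n0 (s x).
  move: kn0; set a := birkhoff_sum _ _ _; lra.
apply: (cvgr_to_ge Dg); apply: nearW => n.
have iM k : m.-integrable setT (EFin \o maxsum g k).
  apply: (@bounded_prob_integrable _ (k%:R * B)) => [|x].
    exact: measurable_maxsum.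
  by rewrite ger0_norm// maxsum_le.
have iMs k : m.-integrable setT (EFin \o (maxsum g k \o s)).
  apply: (@bounded_prob_integrable _ (k%:R * B)) => [|x].
    by apply: measurableT_comp => //; exact: measurable_maxsum.
  by rewrite ger0_norm//= maxsum_le.
rewrite (@RintegralB _ _ _ m setT (maxsum g n.+1) (maxsum g n \o s))//.
rewrite (@Rintegral_preserving (maxsum g n) (n%:R * B)).
- by rewrite subr_ge0; apply: le_Rintegral => // x _; exact: maxsumS.
- exact: measurable_maxsum.
- by move=> x; rewrite ger0_norm// maxsum_le.
Qed.

(** The function f - c has negative integral, so its Birkhoff sums are bounded above. *)
Lemma birkhoff_sum_le (f : T -> R) (B c : R) : measurable_fun setT f ->
  (forall x, `|f x| <= B) -> \int[m]_x f x < c ->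
  \forall x \ae m, exists K : nat, forall n,
    birkhoff_sum f n x <= c * n%:R + K%:R.
Proof.
move=> mf fB fc.
have := @birkhoff_sum_bounded (fun x => f x - c) (B + `|c|).
have -> : \int[m]_x (f x - c) = \int[m]_x f x - c.
  rewrite RintegralB//; last 2 first.
  - exact: (@bounded_prob_integrable _ B).
  - exact: (@bounded_prob_integrable (cst c) `|c|).
  by rewrite Rintegral_cst// [X in fine X](_ : _ = 1%E) ?mulr1//
    -(probability_setT m).
move=> H; apply: filterS (H _ _ _) => [x [K xK]|||].
- exists K => n; have := xK n; rewrite /birkhoff_sum sumrB.
  by rewrite sumr_const card_ord -mulr_natr; lra.
- exact: measurable_funB.
- by move=> x; rewrite (le_trans (ler_normB _ _))// lerD2r.
- by rewrite subr_lt0.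
Qed.

(* Maker's argument: the Birkhoff sums of f_N are dominated by those of the
   fixed function sup_{n >= M} f_n, whose integral is close to that of the limit
   when M is large. *)
Lemma birkhoff_sum_cvg_le (f_ : nat -> T -> R) (F : T -> R) (B c : R) :
  (forall n, measurable_fun setT (f_ n)) -> measurable_fun setT F ->
  (forall n x, `|f_ n x| <= B) ->
  (\forall x \ae m, f_ ^~ x @ \oo --> F x) -> \int[m]_x F x < c ->
  \forall x \ae m, exists M K : nat, forall N n, (M <= N)%N ->
    birkhoff_sum (f_ N) n x <= c * n%:R + K%:R.
Proof.
move=> mf mF fB fF Fc.
have ubf x : has_ubound (range (f_ ^~ x)).
  by exists B => _ [n _ <-]; move: (fB n x); rewrite ler_norml => /andP[].
pose U n x := sups (f_ ^~ x) n.
have mU n : measurable_fun setT (U n) by exact: measurable_fun_sups.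
have leU M N x : (M <= N)%N -> f_ N x <= U M x.
  move=> MN; apply: ub_le_sup; last by exists N.
  exact/has_ubound_sdrop.
have UB n x : `|U n x| <= B.
  rewrite ler_norml; apply/andP; split.
    apply: le_trans (leU n n x (leqnn n)).
    by move: (fB n x); rewrite ler_norml => /andP[].
  apply: ge_sup; first by exists (f_ n x), n => /=.
  by move=> _ [k _ <-]; move: (fB k x); rewrite ler_norml => /andP[].
have UF : \int[m]_x U n x @[n --> \oo] --> \int[m]_x F x.
  apply: (@bounded_cvg_Rintegral _ _ B _ _ _ _).2 => //.
  by apply: filterS fF => x fx; exact: cvg_sups.
have [M _ /(_ M (leqnn M)) UMc] := cvgr_lt _ UF _ Fc.
apply: filterS (birkhoff_sum_le (mU M) (UB M) UMc) => x [K xK].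
exists M, K => N n MN; apply: le_trans (xK n).
by apply: ler_sum => i _; exact: leU.
Qed.

(** The one-sided bound is applied to f_N and to - f_N with slack 1 / (j + 1), for all j at once;
    the additive constant K disappears after division by N. The sequence k is quantified inside the
    almost-everywhere statement because the times used later depend on the base point. *)
Lemma birkhoff_sum_cvg (f_ : nat -> T -> R) (F : T -> R) (B : R) :
  (forall n, measurable_fun setT (f_ n)) -> (forall n x, `|f_ n x| <= B) ->
  (\forall x \ae m, f_ ^~ x @ \oo --> F x) ->
  \forall x \ae m, forall k : nat -> nat,
    (k N)%:R / N%:R @[N --> \oo] --> (1 : R) ->
    N%:R^-1 * birkhoff_sum (f_ N) (k N) x @[N --> \oo] --> \int[m]_x F x.
Proof.
move=> mf fB fF.
(* F is only an almost-everywhere limit and may fail to be measurable; the upper limit G is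
   measurable and agrees with F almost everywhere. *)
pose G x := limn_sup (f_ ^~ x).
have GF : \forall x \ae m, G x = F x.
  by apply: filterS fF => x fx; apply/cvg_lim => //; exact: cvg_sups.
have mG : measurable_fun setT G.
  by apply: measurable_fun_limn_sup => // x _; [exists B|exists (- B)];
    move=> _ [n _ <-]; move: (fB n x); rewrite ler_norml => /andP[].
have fG : \forall x \ae m, f_ ^~ x @ \oo --> G x.
  by move: fF GF; apply: filterS2 => x fx ->.
have -> : \int[m]_x F x = \int[m]_x G x.
  congr fine; apply: ae_eq_integral_nonmeasurable.
  by apply: filterS GF => x ->.
set I := \int[m]_x G x.
have [iG _] := bounded_cvg_Rintegral mf mG fB fG.
have IN : \int[m]_x - G x = - I.
  by under eq_Rintegral do rewrite -mulN1r; rewrite RintegralZl// mulN1r.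
have upper : \forall x \ae m, forall j : nat, exists M K : nat, forall N n,
    (M <= N)%N -> birkhoff_sum (f_ N) n x <= (I + j.+1%:R^-1) * n%:R + K%:R.
  apply/ae_foralln => j; apply: (@birkhoff_sum_cvg_le _ _ B) fG _ => //.
  by rewrite ltrDl invr_gt0.
have lower : \forall x \ae m, forall j : nat, exists M K : nat, forall N n,
    (M <= N)%N ->
    birkhoff_sum (fun y => - f_ N y) n x <= (- I + j.+1%:R^-1) * n%:R + K%:R.
  apply/ae_foralln => j.
  apply: (@birkhoff_sum_cvg_le (fun N y => - f_ N y) (fun y => - G y) B) => //.
  - by move=> n; exact: measurableT_comp.
  - exact: measurableT_comp.
  - by move=> n x; rewrite normrN.
  - by apply: filterS fG => x fx; exact: cvgN.
  - by rewrite IN ltrDl invr_gt0.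
move: upper lower; apply: filterS2 => x up lo k k1.
apply/cvgrPdist_le => e e0.
pose j := Num.truncn (2 / e).
have je : j.+1%:R^-1 < e / 2.
  by rewrite -[e / 2]invrK ltf_pV2 ?posrE ?invr_gt0 ?divr_gt0// invf_div
    truncnS_gt.
have [M1 [K1 up1]] := up j; have [M2 [K2 lo2]] := lo j.
have bound (c K : R) : c * ((k N)%:R / N%:R) + K / N%:R @[N --> \oo] --> c.
  rewrite -[X in _ --> X]addr0 -[X in _ --> X + _]mulr1.
  rewrite -[X in _ --> _ + X](mulr0 K).
  apply: cvgD; first exact: cvgMr.
  apply: cvgMr; exact: cvg_invn.
have {}je : j.+1%:R^-1 < e by apply: lt_trans je _; lra.
have ub := cvgr_le _ (bound (I + j.+1%:R^-1) K1%:R) (I + e).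
have lb := cvgr_le _ (bound (- I + j.+1%:R^-1) K2%:R) (- I + e).
near=> N.
have N0 : (0 < N)%N by near: N; exact: nbhs_infty_gt.
have sc (a b c : R) : a <= b * (k N)%:R + c ->
    N%:R^-1 * a <= b * ((k N)%:R / N%:R) + c / N%:R.
  move=> ab; rewrite mulrA -mulrDl mulrC ler_pM2r// invr_gt0 ltr0n//.
rewrite ler_distl; apply/andP; split.
  rewrite lerBlDr.
  apply: le_trans (sc _ _ _ (up1 N (k N) _)) _.
    by near: N; exact: nbhs_infty_ge.
  by near: N; apply: ub; rewrite ltrD2l.
suff : N%:R^-1 * birkhoff_sum (fun y => - f_ N y) (k N) x <= - I + e.
  by rewrite /birkhoff_sum sumrN mulrN lerNl opprD opprK lerBlDr.
apply: le_trans (sc _ _ _ (lo2 N (k N) _)) _.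
  by near: N; exact: nbhs_infty_ge.
by near: N; apply: lb; rewrite ltrD2l.
Unshelve. all: by end_near. Qed.

End ergodic_theorem.

(** * Integrals against indicator functions *)

Section integral_against_indicator.
Context d (T : measurableType d) (R : realType).
Variable mu : {measure set T -> \bar R}.

(** The indicator is a factor of the integrand, as in the conformality hypothesis on survivor
    sets. *)
Definition wint (f : T -> R) (A : set T) : R := \int[mu]_x (f x * \1_A x).

Lemma mulr_indicE (f : T -> R) A : (fun x => f x * \1_A x) = f \_ A.
Proof.
by apply/funext => x; rewrite /patch indicE; case: ifP; rewrite ?mulr1 ?mulr0.
Qed.

Lemma integrable_mulr_indic (f : T -> R) A : measurable A ->
  mu.-integrable setT (EFin \o f) ->
  mu.-integrable setT (EFin \o (fun x => f x * \1_A x)).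
Proof.
move=> mA fi; rewrite mulr_indicE -restrict_EFin.
apply: (integrable_mkcond _ mA).1; exact: integrableS fi.
Qed.

Lemma wintE f A : wint f A = \int[mu]_(x in A) f x.
Proof. by rewrite /wint mulr_indicE -Rintegral_mkcond. Qed.

Lemma wintU f A A' : measurable A -> measurable A' ->
  mu.-integrable setT (EFin \o f) -> A `&` A' = set0 ->
  wint f (A `|` A') = wint f A + wint f A'.
Proof.
move=> mA mA' fi AA'; rewrite !wintE Rintegral_setU//.
  by apply: integrableS fi => //; exact: measurableU.
by apply/disj_setPS; rewrite AA'.
Qed.

Lemma wintD f f' A : measurable A -> mu.-integrable setT (EFin \o f) ->
  mu.-integrable setT (EFin \o f') ->
  wint (fun x => f x + f' x) A = wint f A + wint f' A.
Proof.
move=> mA fi fi'; rewrite !wintE RintegralD//.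
  exact: integrableS fi.
exact: integrableS fi'.
Qed.

Lemma wintZ c f A : measurable A -> mu.-integrable setT (EFin \o f) ->
  wint (fun x => c * f x) A = c * wint f A.
Proof.
by move=> mA fi; rewrite !wintE RintegralZl//; exact: integrableS fi.
Qed.

Lemma le_wint f f' A : measurable A -> mu.-integrable setT (EFin \o f) ->
  mu.-integrable setT (EFin \o f') -> (forall x, A x -> f x <= f' x) ->
  wint f A <= wint f' A.
Proof.
move=> mA fi fi' ff'; rewrite !wintE; apply: le_Rintegral => //;
  by [exact: integrableS fi|exact: integrableS fi'].
Qed.

Lemma wint_ge0 f A : (forall x, A x -> 0 <= f x) -> 0 <= wint f A.
Proof. by move=> f0; rewrite wintE; exact: Rintegral_ge0. Qed.

Lemma ae_norm_wint f A c : measurable A -> mu.-integrable setT (EFin \o f) ->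
  mu.-integrable setT (EFin \o cst c) ->
  (\forall x \ae mu, `|f x| <= c) -> `|wint f A| <= wint (cst c) A.
Proof.
move=> mA fi ci fc.
have fiA := integrable_mulr_indic mA fi.
have ciA := integrable_mulr_indic mA ci.
apply: (le_trans (le_normr_Rintegral _ fiA)) => //.
rewrite -lee_fin /wint /Rintegral !fineK; last 2 first.
- exact: integrable_fin_num ciA.
- apply: integrable_fin_num => //.
  exact: (integrable_abse fiA).
rewrite [leRHS](@ae_eq_integral _ _ _ _ _ (fun x => `|c * \1_A x|%:E)) //.
- apply: ae_ge0_le_integral => //.
  + apply/measurable_EFinP/measurableT_comp => //.
    exact/measurable_EFinP/(measurable_int mu).
  + apply/measurable_EFinP/measurableT_comp => //.
    exact/measurable_EFinP/(measurable_int mu ciA).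
  + apply: filterS fc => x fcx _; rewrite lee_fin !normrM ler_wpM2r//.
    by rewrite (le_trans fcx)// ler_norm.
- exact: measurable_int ciA.
- apply/measurable_EFinP/measurableT_comp => //.
  exact/measurable_EFinP/(measurable_int mu ciA).
- apply: filterS fc => x fcx _; rewrite ger0_norm// mulr_ge0//.
  exact: le_trans fcx.
Qed.

End integral_against_indicator.

(** * Survivor sets *)

Section open_system.
Context d (Omega : measurableType d) (R : realType).
Variables (m : probability Omega R) (X : completePseudoMetricType R).
Variable S : system_data Omega X.
Hypothesis hS : random_open_system m S.

Local Notation sig := (sd_sig S).
Local Notation J := (sd_J S).
Local Notation T := (sd_T S).
Local Notation Xsurv := (Xsurv S).
Local Notation hole := (hole S).
Local Notation Titer := (Titer S).

Lemma TiterSr n w x : Titer n.+1 w x = Titer n (sig w) (T w x).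
Proof.
elim: n => [//|n IH]; rewrite [LHS]/= [RHS]/= -iterSr; congr (T _ _).
exact: IH.
Qed.

(** A member of the trace sigma-algebra on [J0] has the form C intersected with [J0]. *)
Lemma hole_sub_J e w : hole e w `<=` J w.
Proof.
move=> x [e0 Hx]; have [C mC CE] := ros_H_meas hS e0.
by move: Hx; rewrite -CE => -[].
Qed.

Lemma Xsurv0 e w : Xsurv 0 e w = Jeps S e w.
Proof.
apply/seteqP; split => [x [Jx nh]|x [Jx nh]]; split => //.
  exact: (nh 0%N).
by move=> [|j].
Qed.

Lemma XsurvS n e w x : J w x ->
  Xsurv n.+1 e w x <-> Jeps S e w x /\ Xsurv n e (sig w) (T w x).
Proof.
move=> Jx; split.
  move=> [_ nh]; split; first by split => //; exact: (nh 0%N).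
  split=> [|j jn]; first exact: (ros_T_maps hS).
  by rewrite -iterSr -TiterSr; exact: nh.
move=> [[_ nh0] [_ nh]]; split => // -[|j] jn //.
by rewrite TiterSr iterSr; exact: nh.
Qed.

(** A preimage y of x survives n + 1 steps iff y avoids the hole and x survives n steps. The second
    condition depends on x alone, so it factors out of the sum over preimages. *)
Lemma transfer_Xsurv n e w (f : X -> R) x :
  transfer S w (fun y => f y * \1_(Xsurv n.+1 e w) y) x =
  transfer S w (fun y => f y * \1_(Jeps S e w) y) x *
    \1_(Xsurv n e (sig w)) x.
Proof.
rewrite /transfer /rsum [\1_(Xsurv n e _) x]indicE.
have [xX|xX] := boolP (x \in Xsurv n e (sig w)).
  rewrite mulr1; congr (fine _ - fine _); apply: eq_esum => y [Jy Ty];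
    rewrite !indicE; suff -> : (y \in Xsurv n.+1 e w) = (y \in Jeps S e w) by [];
    apply/idP/idP; rewrite !inE XsurvS//; try (by case);
    by move=> ?; split => //; rewrite Ty; rewrite inE in xX.
rewrite mulr0.
have yX y : J w y /\ T w y = x -> (y \in Xsurv n.+1 e w) = false.
  move=> [Jy Ty]; apply/negP; rewrite inE XsurvS// => -[_]; rewrite Ty => h.
  by move: xX; rewrite (mem_set h).
by rewrite !esum1 ?subrr// => y /yX yE; rewrite indicE yE mulr0 mul0r ?oppr0 maxxx.
Qed.

Lemma measurable_J w : measurable (J w : set (borel X)).
Proof.
rewrite -[J w]setCK; apply: measurableC; apply: sub_sigma_algebra.
by rewrite -closedC setCK; exact: (ros_J_closed hS).
Qed.

(** The graph [J0] need not be product-measurable, but its fibres are closed: the hole is a section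
    of a product-measurable set cut by [J w]. *)
Lemma measurable_hole e w : measurable (hole e w : set (borel X)).
Proof.
have [e0|e0] := posnP e.
  rewrite (_ : hole e w = set0); first exact: measurable0.
  by apply/seteqP; split => x []; rewrite e0.
have [C mC CE] := ros_H_meas hS e0.
rewrite (_ : hole e w = xsection C w `&` J w).
  by apply: measurableI; [exact: measurable_xsection|exact: measurable_J].
apply/seteqP; split => x.
  by move=> [_]; rewrite -CE => -[Cx Jx]; split => //; rewrite /xsection /= inE.
by move=> []; rewrite /xsection /= inE => Cx Jx; split => //; rewrite -CE.
Qed.

Lemma measurable_Tpreimage w (A : set (borel X)) : measurable A ->
  measurable (J w `&` T w @^-1` A : set (borel X)).
Proof.
move=> mA; have [C mC CE] := ros_M1 hS (measurableX measurableT mA).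
rewrite (_ : _ `&` _ = xsection C w `&` J w).
  by apply: measurableI; [exact: measurable_xsection|exact: measurable_J].
have CEx x : (C `&` J0 S) (w, x) <-> J w x /\ A (T w x).
  by rewrite CE /J0 /Defs.skew /=; split => [[? []]|[? ?]].
apply/seteqP; split => x.
  by move=> /CEx[Cx Jx]; split => //; rewrite /xsection /= inE.
by move=> []; rewrite /xsection /= inE => Cx Jx; exact/CEx.
Qed.

Lemma measurable_Titer_preimage n w (A : set (borel X)) : measurable A ->
  measurable (J w `&` Titer n w @^-1` A : set (borel X)).
Proof.
elim: n w => [|n IH] w mA.
  by apply: measurableI => //; exact: measurable_J.
have -> : J w `&` Titer n.+1 w @^-1` A =
    J w `&` T w @^-1` (J (sig w) `&` Titer n (sig w) @^-1` A).
  apply/seteqP; split => x [Jx Ax]; split => //.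
    split; first exact: (ros_T_maps hS).
    by rewrite /preimage /mkset -TiterSr.
  by rewrite /preimage /mkset TiterSr; case: Ax.
by apply: measurable_Tpreimage; exact: IH.
Qed.

Lemma measurable_hit n e w :
  measurable (J w `&` Titer n w @^-1` hole e (iter n sig w) : set (borel X)).
Proof. by apply: measurable_Titer_preimage; exact: measurable_hole. Qed.

Lemma measurable_Xsurv n e w : measurable (Xsurv n e w : set (borel X)).
Proof.
rewrite (_ : Xsurv n e w = J w `\`
    \bigcup_(j in [set j | (j <= n)%N])
      (J w `&` Titer j w @^-1` hole e (iter j sig w))).
  apply: measurableD; first exact: measurable_J.
  by apply: bigcup_measurable => j _; exact: measurable_hit.
apply/seteqP; split => x [Jx nh]; split => //.
  by move=> [j jn [_ hj]]; exact: (nh j jn).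
by move=> j jn hj; apply: nh; exists j.
Qed.

End open_system.

(** * Transfer operators on a regular orbit *)

Section regular_fibers.
Context d (Omega : measurableType d) (R : realType).
Variables (m : probability Omega R) (X : completePseudoMetricType R).
Variable S : system_data Omega X.
Hypothesis hS : random_open_system m S.

Local Notation sig := (sd_sig S).
Local Notation sigV := (sd_sigV S).
Local Notation J := (sd_J S).
Local Notation T := (sd_T S).
Local Notation B := (sd_B S).
Local Notation L := (sd_L S).
Local Notation nu := (sd_nu S).
Local Notation lam := (sd_lam S).
Local Notation phi := (sd_phi S).
Local Notation Q := (sd_Q S).
Local Notation Xsurv := (Xsurv S).
Local Notation hole := (hole S).
Local Notation Titer := (Titer S).
Local Notation mu0 := (mu0 S).
Local Notation nuint := (nuint S).

Variables (beta : nat -> R) (C2 C3 : R) (N0 : nat).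
Hypothesis C3_ge1 : 1 <= C3.
Hypothesis C2_ge0 : 0 <= C2.
Hypothesis beta_ge0 : forall n, (0 < n)%N -> 0 <= beta n.

(** The almost-everywhere hypotheses at one base point, so that the arguments along an orbit become
    deterministic. Here [beta n] bounds the n-th iterate of Q on phi_0 uniformly in the hole, and
    [N0] is the index from which phi_N is nonnegative. *)
Record regular_fiber (w : Omega) : Prop := {
  rf_prob : nu 0 w setT = 1%E ;
  rf_int : forall f : B w,
    (nu 0 w).-integrable setT (EFin \o (ev f : borel X -> R)) ;
  rf_conformal : forall (f : B w) (n e : nat),
    nuint 0 (sig w) (transfer S w (fun y => ev f y * \1_(Xsurv n e w) y))
    = lam 0 w * nuint 0 w (fun y => ev f y * \1_(Xsurv n e w) y) ;
  rf_eigen : forall e, L e w (phi e w) = lam e w *: phi e (sig w) ;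
  rf_decomp : forall e (f : B w),
    (lam e w)^-1 *: L e w f = nuint e w (ev f) *: phi e (sig w) + Q e w f ;
  rf_nuQ : forall e (f : B w), nuint e (sig w) (ev (Q e w f)) = 0 ;
  rf_norm : forall e, nuint 0 w (ev (phi e w)) = 1 ;
  rf_lam : forall e, 0 < lam e w ;
  rf_Q : forall n, (0 < n)%N -> forall e,
    (supnorm (Qiter e n (phi 0 w)) <= (beta n)%:E)%E ;
  rf_phi : forall e, (supnorm (phi e w) <= C2%:E)%E ;
  rf_phi0 : forall x, J w x -> C3^-1 <= ev (phi 0 w) x ;
  rf_phi_ge0 : forall N, (N0 <= N)%N -> forall x, J w x -> 0 <= ev (phi N w) x ;
  rf_inv : forall A : set (borel X), measurable A ->
    mu0 w (J w `&` T w @^-1` A) = mu0 (sig w) A }.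

(** A real-valued counterpart of [mu0]; the two agree on measurable sets by [mu0E]. *)
Definition mass (w : Omega) (A : set (borel X)) : R :=
  wint (nu 0 w) (ev (phi 0 w)) A.

Definition lamprod e n w : R := \prod_(i < n) lam e (iter i sig w).

Fixpoint Liter (e n : nat) (w : Omega) : B w -> B (iter n sig w) :=
  match n return B w -> B (iter n sig w) with
  | 0%N => id
  | k.+1 => fun f => L e (iter k sig w) (Liter e k f)
  end.

Definition regular_orbit w := forall n, regular_fiber (iter n sig w).

Lemma regular_orbitS w : regular_orbit w -> regular_orbit (sig w).
Proof. by move=> rw n; rewrite -iterSr; exact: rw. Qed.

Lemma lamprodSr e n w : lamprod e n.+1 w = lamprod e n w * lam e (iter n sig w).
Proof. by rewrite /lamprod big_ord_recr. Qed.

Lemma lamprod_gt0 e n w : regular_orbit w -> 0 < lamprod e n w.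
Proof. by move=> rw; apply: prodr_gt0 => i _; exact: rf_lam. Qed.

Lemma evD w (f h : B w) x : ev (f + h) x = ev f x + ev h x.
Proof. by rewrite -[f in LHS]scale1r ev_linear mul1r. Qed.

Lemma evZ w a (f : B w) x : ev (a *: f) x = a * ev f x.
Proof.
have ev0 : ev (0 : B w) x = 0.
  have := ev_linear 1 (0 : B w) 0 x; rewrite scale1r addr0 mul1r.
  by move=> /eqP; rewrite -subr_eq0 opprD addNKr oppr_eq0 => /eqP.
by rewrite -[X in ev X]addr0 ev_linear ev0 addr0.
Qed.

Lemma nuint_wint w (f : B w) : nuint 0 w (ev f) = wint (nu 0 w) (ev f) (J w).
Proof.
rewrite /nuint /wint; apply: eq_Rintegral => x _; rewrite indicE.
have [|xJ] := boolP (x \in J w); first by rewrite mulr1.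
by rewrite mulr0 ev_off// => Jx; move: xJ; rewrite (mem_set Jx).
Qed.

Lemma mu0E w (A : set (borel X)) : regular_fiber w -> measurable A ->
  mu0 w A = (mass w A)%:E.
Proof.
move=> rw mA; rewrite /mass /wint /Rintegral fineK; last first.
  apply: integrable_fin_num => //.
  by apply: integrable_mulr_indic => //; exact: rf_int.
rewrite /mu0 integral_mkcond; apply: eq_integral => x _.
by rewrite /= /patch indicE; case: ifP; rewrite ?mulr1 ?mulr0.
Qed.

Lemma ae_le_supnorm w (f : B w) c : regular_fiber w ->
  (supnorm f <= c%:E)%E -> \forall x \ae nu 0 w, `|ev f x| <= c.
Proof.
(* The L-infinity norm unfolds to an essential supremum only when the total mass is positive. *)
move=> rw; rewrite /supnorm unlock [X in (0 < X)%E](rf_prob rw) lte01.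
by move=> /ess_supP; apply: filterS => x /=; rewrite lee_fin.
Qed.

Lemma integrable_cst_fiber w (c : R) : regular_fiber w ->
  (nu 0 w).-integrable setT (EFin \o cst c).
Proof.
move=> rw; apply: measurable_bounded_integrable => //.
  by rewrite [ltLHS](rf_prob rw) ltry.
by exists `|c|; split=> [|M /ltW cM x _]; [exact: num_real|exact: cM].
Qed.

Lemma mass_ge0 w (A : set (borel X)) : regular_fiber w -> A `<=` J w ->
  0 <= mass w A.
Proof.
move=> rw AJ; apply: wint_ge0 => x /AJ /(rf_phi0 rw).
by apply: le_trans; rewrite invr_ge0 (le_trans ler01).
Qed.

Lemma massU w (A A' : set (borel X)) : regular_fiber w ->
  measurable A -> measurable A' -> A `&` A' = set0 ->
  mass w (A `|` A') = mass w A + mass w A'.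
Proof. by move=> rw mA mA'; apply: wintU => //; exact: rf_int. Qed.

Lemma mass_J w : regular_fiber w -> mass w (J w) = 1.
Proof. by move=> rw; rewrite /mass -nuint_wint rf_norm. Qed.

Lemma mass_inv w (A : set (borel X)) : regular_fiber w ->
  regular_fiber (sig w) -> measurable A ->
  mass w (J w `&` T w @^-1` A) = mass (sig w) A.
Proof.
move=> rw rw1 mA; apply: EFin_inj; rewrite -!mu0E//; first exact: rf_inv.
exact: (measurable_Tpreimage hS).
Qed.

Lemma mass_setD w (A A' : set (borel X)) : regular_fiber w ->
  measurable A -> measurable A' -> A' `<=` A ->
  mass w (A `\` A') = mass w A - mass w A'.
Proof.
move=> rw mA mA' A'A; rewrite -[in RHS](setDUK A'A) massU//.
- by rewrite addrAC subrr add0r.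
- exact: measurableD.
- by rewrite setDE setICA setICr setI0.
Qed.

(** Since phi_0 >= 1 / C3, the constant c is at most c C3 phi_0; this turns a sup-norm bound into a
    bound by the invariant measure of A. *)
Lemma norm_wint_le w (f : B w) c (A : set (borel X)) : regular_fiber w ->
  measurable A -> A `<=` J w -> (supnorm f <= c%:E)%E -> 0 <= c ->
  `|wint (nu 0 w) (ev f) A| <= c * C3 * mass w A.
Proof.
move=> rw mA AJ fc c0.
have iphi := rf_int rw (phi 0 w).
have ic a := integrable_cst_fiber a rw.
apply: (@le_trans _ _ (wint (nu 0 w) (cst c) A)).
  by apply: ae_norm_wint => //; [exact: rf_int|exact: ae_le_supnorm].
rewrite /mass -wintZ//; apply: le_wint => // [|x Ax].
  rewrite -[EFin \o _]/(fun x => ((c * C3)%:E * (ev (phi 0 w) x)%:E)%E).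
  exact: integrableZl.
rewrite -mulrA /= ler_peMr// -ler_pdivrMl ?(lt_le_trans ltr01)// mulr1.
exact/rf_phi0/AJ.
Qed.

Lemma norm_nuint_le w (f : B w) c : regular_fiber w ->
  (supnorm f <= c%:E)%E -> `|nuint 0 w (ev f)| <= c.
Proof.
move=> rw fc; rewrite /nuint.
have -> : \int[nu 0 w]_x ev f x = wint (nu 0 w) (ev f) setT.
  by apply: eq_Rintegral => x _; rewrite indicE in_setT mulr1.
apply: le_trans (ae_norm_wint measurableT (rf_int rw f)
  (integrable_cst_fiber c rw) (ae_le_supnorm rw fc)) _.
by rewrite wintE Rintegral_cst// [X in fine X](rf_prob rw) mulr1.
Qed.

(* Conformality on survivor sets moves the first step of the orbit out of the
   indicator. *)
Lemma wint_Liter n k e w (f : B w) : regular_orbit w ->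
  wint (nu 0 w) (ev f) (Xsurv (k + n)%N e w) * lamprod 0 k w =
  wint (nu 0 (iter k sig w)) (ev (Liter e k f)) (Xsurv n e (iter k sig w)).
Proof.
move=> rw; elim: k n => [|k IH] n; first by rewrite /lamprod big_ord0 mulr1.
rewrite lamprodSr mulrA addSnnS IH mulrC -[LHS](rf_conformal (rw k)).
by congr (fine _); apply: eq_integral => x _; rewrite (transfer_Xsurv hS)// (ros_L hS).
Qed.

(** One step beyond [wint_Liter]: the remaining indicator, of [Xsurv 0], is that of the complement
    of the hole and is absorbed into L_e. *)
Lemma wint_LiterS k e w (f : B w) : regular_orbit w ->
  wint (nu 0 w) (ev f) (Xsurv k e w) * lamprod 0 k.+1 w =
  nuint 0 (iter k.+1 sig w) (ev (Liter e k.+1 f)).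
Proof.
move=> rw; rewrite lamprodSr mulrA -[k in Xsurv k](addn0 k) wint_Liter//.
rewrite mulrC -[LHS](rf_conformal (rw k)).
by congr (fine _); apply: eq_integral => x _; rewrite (ros_L hS) Xsurv0.
Qed.

(** phi_e is carried along with factor lam_e, while nu_e vanishes on the range of Q_e, so on that
    range L_e acts as lam_e Q_e. *)
Lemma Liter_decomp k e w (f : B w) : regular_orbit w ->
  Liter e k.+1 f = lamprod e k.+1 w *:
    (nuint e w (ev f) *: phi e (iter k.+1 sig w) + Qiter e k.+1 f).
Proof.
move=> rw; elim: k => [|k IH].
  rewrite /= -(rf_decomp (rw 0%N)) scalerA /lamprod big_ord1 /= divff ?scale1r//.
  by rewrite gt_eqF// (rf_lam (rw 0%N)).
rewrite -[LHS]/(L e (iter k.+1 sig w) (Liter e k.+1 f)) IH (lamprodSr e k.+1).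
have l0 : lam e (iter k.+1 sig w) != 0 by rewrite gt_eqF// (rf_lam (rw k.+1)).
rewrite linearZZ linearD linearZZ (rf_eigen (rw k.+1)).
rewrite -[Qiter e k.+2 f]/(Q e (iter k.+1 sig w) (Qiter e k.+1 f)).
have := rf_decomp (rw k.+1) e (Qiter e k.+1 f).
have -> : nuint e (iter k.+1 sig w) (ev (Qiter e k.+1 f)) = 0.
  exact: (rf_nuQ (rw k)).
rewrite scale0r add0r => {}IH; rewrite -IH.
by rewrite -scalerA; congr (_ *: _); rewrite scalerDr !scalerA divff// scale1r mulrC.
Qed.

Lemma wint_evD w (f h : B w) (A : set (borel X)) : regular_fiber w ->
  measurable A -> wint (nu 0 w) (ev (f + h)) A =
  wint (nu 0 w) (ev f) A + wint (nu 0 w) (ev h) A.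
Proof.
move=> rw mA; rewrite -wintD//; first last.
- exact: rf_int.
- exact: rf_int.
by congr wint; apply/funext => x; rewrite evD.
Qed.

Lemma wint_evZ w a (f : B w) (A : set (borel X)) : regular_fiber w ->
  measurable A -> wint (nu 0 w) (ev (a *: f)) A = a * wint (nu 0 w) (ev f) A.
Proof.
move=> rw mA; rewrite -wintZ//; last exact: rf_int.
by congr wint; apply/funext => x; rewrite evZ.
Qed.

Lemma nuint_evD w (f h : B w) : regular_fiber w ->
  nuint 0 w (ev (f + h)) = nuint 0 w (ev f) + nuint 0 w (ev h).
Proof.
by move=> rw; rewrite !nuint_wint wint_evD//; exact: (measurable_J hS).
Qed.

Lemma nuint_evZ w a (f : B w) : regular_fiber w ->
  nuint 0 w (ev (a *: f)) = a * nuint 0 w (ev f).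
Proof.
by move=> rw; rewrite !nuint_wint wint_evZ//; exact: (measurable_J hS).
Qed.

Lemma wint_hole e w (f : B w) : regular_fiber w ->
  wint (nu 0 w) (ev f) (hole e w) =
  nuint 0 w (ev f) - wint (nu 0 w) (ev f) (Xsurv 0 e w).
Proof.
move=> rw; rewrite nuint_wint Xsurv0 /Jeps.
rewrite -[X in wint _ _ X - _](setDUK (@hole_sub_J _ _ _ _ _ _ hS e w)) wintU.
- by rewrite addrK.
- exact: (measurable_hole hS).
- by apply: measurableD; [exact: (measurable_J hS)|exact: (measurable_hole hS)].
- exact: rf_int.
- by rewrite setDE setICA setICr setI0.
Qed.

(** * Escape rates and survival probabilities *)

Definition lamratio e n w := lamprod e n w / lamprod 0 n w.

Definition escape e w := wint (nu 0 w) (ev (phi e w)) (hole e w).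

(** Integrating the eigenvalue equation of phi_e against nu_0 gives lam_e = lam_0 nu_0(phi_e
    1_{J_e}), and nu_0(phi_e) = 1. *)
Lemma lam_escape e w : regular_fiber w -> regular_fiber (sig w) ->
  lam e w = lam 0 w * (1 - escape e w).
Proof.
move=> rw rw1; rewrite /escape wint_hole// rf_norm// opprB addrC subrK.
rewrite -[RHS](rf_conformal rw).
have := congr1 (fun f => nuint 0 (sig w) (ev f)) (rf_eigen rw e).
rewrite nuint_evZ// rf_norm// mulr1 => <-.
by congr (fine _); apply: eq_integral => x _; rewrite (ros_L hS) Xsurv0.
Qed.

Lemma lamratio_prod e n w : regular_orbit w ->
  lamratio e n w = \prod_(i < n) (1 - escape e (iter i sig w)).
Proof.
move=> rw; rewrite /lamratio /lamprod -prodf_div; apply: eq_bigr => i _.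
by rewrite (lam_escape e (rw i) (rw i.+1)) mulrC mulKf// gt_eqF// (rf_lam (rw i)).
Qed.

Lemma mass_Xsurv k e w : regular_orbit w ->
  mass w (Xsurv k e w) = lamratio e k.+1 w *
    (nuint e w (ev (phi 0 w)) +
     nuint 0 (iter k.+1 sig w) (ev (Qiter e k.+1 (phi 0 w)))).
Proof.
move=> rw; have l0 := lamprod_gt0 0 k.+1 rw.
rewrite /lamratio mulrAC; apply/(canRL (mulfK _)); first by rewrite gt_eqF.
rewrite wint_LiterS// Liter_decomp// nuint_evZ; last exact: (rw k.+1).
rewrite nuint_evD; last exact: (rw k.+1).
by rewrite nuint_evZ ?(rf_norm (rw k.+1)) ?mulr1; last exact: (rw k.+1).
Qed.

(** Both survival probabilities, multiplied by lam_0^{k+1}, are integrals of the same function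
    L_e^{k+1} phi_0, over the whole fibre and off the hole. Their difference is its integral over
    the hole. *)
Lemma mass_XsurvB k e w : regular_orbit w ->
  mass w (Xsurv k e w) - mass w (Xsurv k.+1 e w) = lamratio e k.+1 w *
    (nuint e w (ev (phi 0 w)) * escape e (iter k.+1 sig w) +
     wint (nu 0 (iter k.+1 sig w)) (ev (Qiter e k.+1 (phi 0 w)))
       (hole e (iter k.+1 sig w))).
Proof.
move=> rw; have l0 := lamprod_gt0 0 k.+1 rw.
have rk : regular_fiber (iter k.+1 sig w) := rw k.+1.
have mh := measurable_hole hS e (iter k.+1 sig w).
rewrite /lamratio mulrAC; apply/(canRL (mulfK _)); first by rewrite gt_eqF.
have := wint_Liter 0 k.+1 e (phi 0 w) rw; rewrite addn0 => XE.
rewrite mulrBl wint_LiterS// [X in _ - X]XE -wint_hole//.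
by rewrite Liter_decomp// wint_evZ// wint_evD// wint_evZ.
Qed.

(** * First-hit and return sets *)

Definition first_hit k e w : set (borel X) := [set x | [/\ J w x,
  forall i, (i < k)%N -> ~ hole e (iter i sig w) (Titer i w x) &
  hole e (iter k sig w) (Titer k w x)]].

(** Its measure is the numerator of [qhat], with times counted forward from the starting fibre. *)
Definition return_set k e w : set (borel X) := [set x | [/\ hole e w x,
  forall i, (1 <= i <= k)%N -> ~ hole e (iter i sig w) (Titer i w x) &
  hole e (iter k.+1 sig w) (Titer k.+1 w x)]].

Lemma first_hitS k e w : first_hit k.+1 e w = Xsurv k e w `\` Xsurv k.+1 e w.
Proof.
apply/seteqP; split => x.
  move=> [Jx nh hk]; split; first by split => // j jk; exact: nh.
  by move=> [_ /(_ k.+1 (leqnn _))]; exact.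
move=> [[Jx nh] nX]; split => //.
apply: contrapT => nhk; apply: nX; split => // j.
by rewrite leq_eqVlt => /predU1P[->//|]; rewrite ltnS; exact: nh.
Qed.

Lemma measurable_first_hit k e w : measurable (first_hit k e w).
Proof.
case: k => [|k].
  rewrite (_ : first_hit 0 e w = hole e w); first exact: (measurable_hole hS).
  apply/seteqP; split => x; first by case.
  by move=> hx; split => //; exact: (hole_sub_J hS hx).
by rewrite first_hitS; apply: measurableD; exact: (measurable_Xsurv hS).
Qed.

Lemma mass_first_hitS k e w : regular_fiber w ->
  mass w (first_hit k.+1 e w) = mass w (Xsurv k e w) - mass w (Xsurv k.+1 e w).
Proof.
move=> rw; rewrite first_hitS mass_setD//; try exact: (measurable_Xsurv hS).
by move=> x [Jx nh]; split => // j jk; apply: nh; exact: leqW.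
Qed.

(** If T x first hits at time k, then x either starts off the hole and first hits at time k + 1, or
    starts in the hole and first returns at time k + 1. *)
Lemma preimage_first_hit k e w :
  J w `&` T w @^-1` first_hit k e (sig w) =
  first_hit k.+1 e w `|` return_set k e w.
Proof.
apply/seteqP; split => x.
  move=> [Jx [_ nh]]; rewrite -iterSr -TiterSr => hk.
  have nh' i : (1 <= i <= k)%N -> ~ hole e (iter i sig w) (Titer i w x).
    by case: i => // i ik; rewrite iterSr TiterSr; exact: nh.
  have [h0|h0] := pselect (hole e w x); first by right.
  by left; split => // -[|i] ik //; exact: nh'.
move=> [[Jx nh hk]|[h0 nh hk]]; (split; [|split]) => //.
- exact: (ros_T_maps hS).
- by move=> i ik; rewrite -iterSr -TiterSr; exact: nh.
- by rewrite -iterSr -TiterSr.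
- exact: (hole_sub_J hS h0).
- exact: (ros_T_maps hS (hole_sub_J hS h0)).
- by move=> i ik; rewrite -iterSr -TiterSr; exact: nh.
- by rewrite -iterSr -TiterSr.
Qed.

Lemma first_hit_return_disjoint k e w :
  first_hit k.+1 e w `&` return_set k e w = set0.
Proof.
apply/seteqP; split => x //.
by move=> [[_ nh _] [h0 _ _]]; exact: (nh 0%N).
Qed.

Lemma measurable_return_set k e w : measurable (return_set k e w).
Proof.
rewrite (_ : return_set k e w =
    (J w `&` T w @^-1` first_hit k e (sig w)) `\` first_hit k.+1 e w).
  apply: measurableD; last exact: measurable_first_hit.
  by apply: (measurable_Tpreimage hS); exact: measurable_first_hit.
rewrite preimage_first_hit setDUl setDv set0U.
rewrite setDE; apply/esym/setIidPl => x rx fx.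
by rewrite -[False]/(set0 x) -(first_hit_return_disjoint k e w).
Qed.

Lemma mass_first_hit_sig k e w : regular_fiber w -> regular_fiber (sig w) ->
  mass (sig w) (first_hit k e (sig w)) =
  mass w (first_hit k.+1 e w) + mass w (return_set k e w).
Proof.
move=> rw rw1; rewrite -mass_inv//; last exact: measurable_first_hit.
rewrite preimage_first_hit massU//.
- exact: measurable_first_hit.
- exact: measurable_return_set.
- exact: first_hit_return_disjoint.
Qed.

Lemma mass_Titer n w (A : set (borel X)) : regular_orbit w -> measurable A ->
  mass w (J w `&` Titer n w @^-1` A) =
  mass (iter n sig w) (J (iter n sig w) `&` A).
Proof.
elim: n w => [//|n IH] w rw mA.
have := IH _ (regular_orbitS rw) mA; rewrite -!iterSr => <-.
rewrite -(mass_inv (rw 0%N) (rw 1%N)); last exact: (measurable_Titer_preimage hS).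
congr mass; apply/seteqP; split => x [Jx Ax]; split => //.
  split; first exact: (ros_T_maps hS).
  by rewrite /preimage /mkset -TiterSr.
by rewrite /preimage /mkset TiterSr; case: Ax.
Qed.

Lemma iter_sigK k w : iter k sig (iter k sigV w) = w.
Proof. by elim: k w => [//|k IH] w; rewrite iterSr /= (ros_sigVK hS) IH. Qed.

Lemma iter_sigVB k j w : (j <= k)%N ->
  iter (k - j) sig (iter k sigV w) = iter j sigV w.
Proof. by move=> jk; rewrite -{2}(subnK jk) iterD iter_sigK. Qed.

(** In the numerator the backward index j becomes the forward time k + 1 - j; the denominator
    reduces to the mass of the hole by invariance. *)
Lemma qhatE N k w : regular_orbit (iter k.+1 sigV w) ->
  qhat S N k w = mass (iter k.+1 sigV w) (return_set k N (iter k.+1 sigV w))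
    / mass w (hole N w).
Proof.
move=> rw; set w' := iter k.+1 sigV w in rw *.
have w'E : iter k.+1 sig w' = w by exact: iter_sigK.
have rw' := rw 0%N.
rewrite /qhat -/w'; congr (_ / _).
  rewrite -[RHS]/(fine (mass w' (return_set k N w'))%:E) -mu0E//; last first.
    exact: measurable_return_set.
  congr (fine (mu0 _ _)); apply/seteqP; split => x.
    move=> [[[Jx hk] nh] h0]; split => //; last by rewrite w'E.
    move=> i /andP[i1 ik]; have ik1 : (k.+1 - i <= k.+1)%N by exact: leq_subr.
    have := nh (k.+1 - i)%N; rewrite -(iter_sigVB w ik1) -/w' subKn;
      last exact: leqW.
    by apply; rewrite subn_gt0 ltnS ik /= leq_subLR; move: i1; lia.
  move=> [h0 nh hk]; split => //; split; first split.
  - exact: (hole_sub_J hS h0).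
  - by rewrite -{1}w'E.
  move=> j /andP[j1 jk]; rewrite -(iter_sigVB w (leqW jk)) -/w'.
  by apply: nh; lia.
rewrite (_ : [set x | _] = J w' `&` Titer k.+1 w' @^-1` hole N w).
  have mh := measurable_hole hS N w.
  rewrite mu0E//; last exact: (measurable_Titer_preimage hS).
  rewrite mass_Titer// w'E; congr mass.
  by apply/setIidPr; exact: (hole_sub_J hS).
by apply/seteqP; split.
Qed.

(** Each step back along the orbit preserves the mass of the first-hit set up to the loss of the
    return set, which is the hole's mass times [qhat]. *)
Lemma mass_first_hit N n w : (forall k, regular_orbit (iter k sigV w)) ->
  mass w (hole N w) != 0 ->
  mass (iter n sigV w) (first_hit n N (iter n sigV w)) =
  mass w (hole N w) * (1 - \sum_(k < n) qhat S N k w).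
Proof.
move=> rw h0; elim: n => [|n IH].
  rewrite big_ord0 subr0 mulr1; congr mass; apply/seteqP; split => x.
    by case.
  by move=> hx; split => //; exact: (hole_sub_J hS hx).
have rn : regular_fiber (iter n.+1 sigV w) := rw n.+1 0%N.
have rn1 : regular_fiber (sig (iter n.+1 sigV w)) := rw n.+1 1%N.
have := mass_first_hit_sig n N rn rn1; rewrite [sig _](ros_sigVK hS) IH.
move=> E; rewrite big_ord_recr /= qhatE// opprD addrA mulrBr E.
by rewrite mulrCA divff// mulr1 addrK.
Qed.

Lemma le_mass w (A A' : set (borel X)) : regular_fiber w -> measurable A ->
  measurable A' -> A `<=` A' -> A' `<=` J w -> mass w A <= mass w A'.
Proof.
move=> rw mA mA' AA' A'J; rewrite -subr_ge0 -mass_setD//.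
by apply: mass_ge0 => // x [/A'J].
Qed.

(** A union bound: by invariance, hitting the hole at time i has at most the mass of the hole over
    the i-th fibre. *)
Lemma mass_Xsurv_bounds n e w : regular_orbit w ->
  1 - \sum_(i < n.+1) mass (iter i sig w) (hole e (iter i sig w)) <=
    mass w (Xsurv n e w) <= 1.
Proof.
move=> rw; have rw0 : regular_fiber w := rw 0%N.
elim: n => [|n /andP[IH1 IH2]].
  have E : mass w (hole e w) = 1 - mass w (Xsurv 0 e w).
    by rewrite /mass wint_hole// rf_norm.
  have h0 : 0 <= mass w (hole e w) by apply: mass_ge0 => //; exact: (hole_sub_J hS).
  by rewrite big_ord1 /= E subKr lexx -subr_ge0 -E.
have E := mass_first_hitS n e rw0.
have f0 : 0 <= mass w (first_hit n.+1 e w) by apply: mass_ge0 => // x [].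
have mh := measurable_hole hS e (iter n.+1 sig w).
have f1 : mass w (first_hit n.+1 e w) <=
    mass (iter n.+1 sig w) (hole e (iter n.+1 sig w)).
  apply: (@le_trans _ _
      (mass w (J w `&` Titer n.+1 w @^-1` hole e (iter n.+1 sig w)))).
    apply: le_mass => //.
    - exact: measurable_first_hit.
    - exact: (measurable_Titer_preimage hS).
    - by move=> x [].
  rewrite (mass_Titer n.+1 rw mh).
  rewrite [X in mass _ X <= _](_ : _ = hole e (iter n.+1 sig w))//.
  by apply/setIidPr; exact: (hole_sub_J hS).
rewrite big_ord_recr /=; move: f1 IH1; rewrite [iter n.+1 sig w]/=.
by move=> f1 IH1; apply/andP; split; lra.
Qed.

(** * Escape rates compared with return probabilities *)

Lemma escape_ge0 N w : regular_fiber w -> (N0 <= N)%N -> 0 <= escape N w.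
Proof.
move=> rw NN; apply: wint_ge0 => x /(hole_sub_J hS).
exact: rf_phi_ge0.
Qed.

Lemma escape_le N w : regular_fiber w ->
  `|escape N w| <= C2 * C3 * mass w (hole N w).
Proof.
move=> rw; apply: norm_wint_le => //.
- exact: (measurable_hole hS).
- exact: (hole_sub_J hS).
- exact: rf_phi.
Qed.

Lemma escape_lt1 e w : regular_fiber w -> regular_fiber (sig w) -> escape e w < 1.
Proof.
move=> rw rw1; have := rf_lam rw e; rewrite lam_escape//.
by rewrite pmulr_rgt0 ?(rf_lam rw)// subr_gt0.
Qed.

Lemma lamratio_itv N n w : regular_orbit w -> (N0 <= N)%N ->
  0 < lamratio N n w <= 1.
Proof.
move=> rw NN; rewrite {1}/lamratio divr_gt0 ?lamprod_gt0//= lamratio_prod//.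
apply: prodr_ile1 => i _.
by rewrite subr_ge0 ltW ?(escape_lt1 _ (rw i) (rw i.+1))//= gerBl (escape_ge0 (rw i)).
Qed.

(** [mass_first_hit] and [mass_XsurvB] evaluate the same first-hit set. Eliminating nu_N(phi_0)
    through [mass_Xsurv] leaves exactly rho (q a - e') / h, where rho <= 1, |q| <= b, |e'| <= b C3 h
    and |a| <= C2 C3 h for b = [beta n.+1]. *)
Lemma escape_return N n w : (forall k, regular_orbit (iter k sigV w)) ->
  (N0 <= N)%N -> 0 < mass w (hole N w) ->
  `|mass (iter n.+1 sigV w) (Xsurv n N (iter n.+1 sigV w)) *
      (escape N w / mass w (hole N w))
    - (1 - \sum_(k < n.+1) qhat S N k w)| <= beta n.+1 * ((C2 + 1) * C3).
Proof.
move=> rw NN h0; set w' := iter n.+1 sigV w.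
have w'E : iter n.+1 sig w' = w by exact: iter_sigK.
have rw' : regular_orbit w' by exact: rw.
have rw0 : regular_fiber w := rw 0%N 0%N.
set h := mass w (hole N w) in h0 *; set a := escape N w.
have hne : h != 0 by rewrite gt_eqF.
have hE := mass_first_hit n.+1 rw hne.
rewrite (mass_first_hitS _ _ (rw' 0%N)) mass_XsurvB// -/h -/w' in hE.
rewrite mass_Xsurv//; have := lamratio_itv n.+1 rw' NN.
set rho := lamratio _ _ _ in hE *; set v := nuint N w' _ in hE *.
set q := nuint 0 _ _; set b := beta _ => /andP[rho0 rho1].
have b0 : 0 <= b by exact: beta_ge0.
have aE : escape N (iter n.+1 sig w') = a by rewrite w'E.
rewrite aE in hE.
set e' := wint _ _ _ in hE.
have qb : `|q| <= b 
  by apply: norm_nuint_le; [exact: (rw' n.+1)|exact: (rf_Q (rw' 0%N))].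
have eb : `|e'| <= b * C3 * h.
  apply: le_trans (norm_wint_le (rw' n.+1) _ _ (rf_Q (rw' 0%N) _ _) _) _ => //.
  - exact: (measurable_hole hS).
  - exact: (hole_sub_J hS).
  - by rewrite w'E.
have ab : `|a| <= C2 * C3 * h by exact: escape_le.
have -> : rho * (v + q) * (a / h) - (1 - \sum_(k < n.+1) qhat S N k w) =
    rho * (q * a - e') / h.
  apply: (mulIf hne); rewrite divfK// mulrBl mulrA divfK// [_ * h]mulrC -hE.
  by ring.
rewrite normrM normfV (gtr0_norm h0) ler_pdivrMr// normrM (gtr0_norm rho0).
apply: (@le_trans _ _ `|q * a - e'|); first by rewrite ler_piMl.
apply: le_trans (ler_normB _ _) _; rewrite normrM.
have : `|q| * `|a| <= b * (C2 * C3 * h) by apply: ler_pM.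
by move: eb; set u := `|q| * _ => ? ?; lra.
Qed.

(** * Limits along one orbit as the holes shrink *)

Section shrinking_holes.
Variables (D : R) (w : Omega).
Hypothesis rw : regular_orbit w.
Hypothesis hD : forall i N, (0 < N)%N ->
  mass (iter i sig w) (hole N (iter i sig w)) <= D / N%:R.

Let cvgD0 K : K * (D / N%:R) @[N --> \oo] --> (0 : R).
Proof.
rewrite -(mulr0 (K * D)); under eq_fun do rewrite mulrA.
by apply: cvgMr; exact: cvg_invn.
Qed.

Lemma cvg_mass_Xsurv n : mass w (Xsurv n N w) @[N --> \oo] --> (1 : R).
Proof.
apply: (@squeeze_cvgr _ _ _ _ (fun N => 1 - n.+1%:R * (D / N%:R)) (fun=> 1)).
- near=> N; have N0' : (0 < N)%N by near: N; exact: nbhs_infty_gt.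
  have /andP[h1 ->] := mass_Xsurv_bounds n N rw; rewrite andbT.
  apply: le_trans h1; rewrite lerD2l lerN2 mulr_natl.
  apply: le_trans (_ : \sum_(i < n.+1) D / N%:R <= _).
    by apply: ler_sum => i _; exact: hD.
  by rewrite sumr_const card_ord.
- rewrite -[X in _ --> X]subr0; apply: cvgB; [exact: cvg_cst|exact: cvgD0].
- exact: cvg_cst.
Unshelve. all: by end_near. Qed.

Lemma cvg_escape i : escape N (iter i sig w) @[N --> \oo] --> (0 : R).
Proof.
apply: (cvg_le_norm (cvgD0 (C2 * C3))); near=> N.
have N0' : (0 < N)%N by near: N; exact: nbhs_infty_gt.
apply: le_trans (escape_le N (rw i)) _; rewrite ler_wpM2l//.
  by rewrite mulr_ge0// (le_trans ler01).
exact: hD.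
Unshelve. all: by end_near. Qed.

Hypothesis beta0 : beta @ \oo --> 0.

(** By [mass_Xsurv] this integral is the survival probability over [lamratio], minus a Q-term. For
    fixed n the quotient tends to 1, and the Q-term is at most [beta n.+1] uniformly in N. *)
Lemma cvg_nu_phi0 : nuint N w (ev (phi 0 w)) @[N --> \oo] --> (1 : R).
Proof.
have rho1 n : lamratio N n w @[N --> \oo] --> (1 : R).
  under eq_fun do rewrite lamratio_prod//.
  apply: (@cvg_prod1 _ (fun i N => 1 - escape N (iter i sig w))) => i.
  by rewrite -[X in _ --> X]subr0; apply: cvgB; [exact: cvg_cst|exact: cvg_escape].
apply/cvgrPdist_le => e e0; have e2 : 0 < e / 2 by rewrite divr_gt0.
have /cvgrPdist_le/(_ _ e2)[n _ /(_ n.+1 (leqnSn _))] := beta0.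
rewrite sub0r normrN => bn.
have m1 : mass w (Xsurv n N w) / lamratio N n.+1 w @[N --> \oo] --> (1 : R).
  rewrite -[X in _ --> X]divr1; apply: cvgM; first exact: cvg_mass_Xsurv.
  by apply: cvgV => //; exact: oner_neq0.
near=> N.
have NN : (N0 <= N)%N by near: N; exact: nbhs_infty_ge.
have : `|1 - mass w (Xsurv n N w) / lamratio N n.+1 w| <= e / 2.
  by near: N; move/cvgrPdist_le : m1; exact.
have /andP[rho0 _] := lamratio_itv n.+1 rw NN.
rewrite mass_Xsurv// mulrAC divff ?gt_eqF// mul1r.
set q := nuint 0 _ _.
have qb : `|q| <= e / 2.
  apply: le_trans (le_trans (ler_norm _) bn).
  by apply: norm_nuint_le; [exact: (rw n.+1)|exact: (rf_Q (rw 0%N))].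
by move: qb; rewrite !ler_norml; lra.
Unshelve. all: by end_near. Qed.

(** In [mass_Xsurv] with k N steps, the product of the 1 - a_i tends to expR (- I), nu_N(phi_0)
    tends to 1 and the Q-term is at most [beta (k N)]. The predecessor appears because [Xsurv n]
    tests the n + 1 times 0, ..., n. *)
Lemma cvg_mass_Xsurv_diag (k : nat -> nat) (I : R) :
  (k N)%:R / N%:R @[N --> \oo] --> (1 : R) ->
  \sum_(i < k N) escape N (iter i sig w) @[N --> \oo] --> I ->
  mass w (Xsurv (k N).-1 N w) @[N --> \oo] --> expR (- I).
Proof.
move=> k1 sI; pose M := C2 * C3 * D.
have knear (c : R) : c < 1 -> \forall N \near \oo, c * N%:R <= (k N)%:R.
  move=> c1; near=> N; have N0' : (0 < N)%N by near: N; exact: nbhs_infty_gt.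
  rewrite -ler_pdivlMr ?ltr0n//; near: N; exact: cvgr_ge k1 _ c1.
have koo : k @ \oo --> \oo.
  apply/cvgnyPge => A; near=> N; rewrite -(ler_nat R).
  apply: (@le_trans _ _ (2^-1 * N%:R)).
    rewrite mulrC ler_pdivlMr// -natrM ler_nat; near: N; exact: nbhs_infty_ge.
  by near: N; apply: knear; rewrite invf_lt1// ltr1n.
have rhoE : lamratio N (k N) w @[N --> \oo] --> expR (- I).
  have eI : expR (- \sum_(i < k N) escape N (iter i sig w)) @[N --> \oo] -->
      expR (- I).
    by apply: continuous_cvg; [exact: continuous_expR|exact: cvgN].
  rewrite -[X in _ --> X]add0r.
  rewrite [X in X @ _ --> _](_ : _ = fun N =>
      (lamratio N (k N) w - expR (- \sum_(i < k N) escape N (iter i sig w)))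
      + expR (- \sum_(i < k N) escape N (iter i sig w))); last first.
    by apply/funext => N; rewrite subrK.
  apply: cvgD => //.
  (* Each escape rate is at most M / N, so the quadratic error of [prod_1B_expR] is at most k N
     times (M / N) ^ 2. *)
  have v0 : (k N)%:R / N%:R * (M ^+ 2 * N%:R^-1) @[N --> \oo] --> 1 * (M ^+ 2 * 0).
    by apply: cvgM => //; apply: cvgMr; exact: cvg_invn.
  rewrite !mulr0 in v0.
  apply: (cvg_le_norm v0); near=> N.
  have N0' : (0 < N)%N by near: N; exact: nbhs_infty_gt.
  have NN : (N0 <= N)%N by near: N; exact: nbhs_infty_ge.
  rewrite lamratio_prod//.
  have e01 i : 0 <= escape N (iter i sig w) <= 1.
    by rewrite (escape_ge0 (rw i))// ltW// (escape_lt1 _ (rw i) (rw i.+1)).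
  apply: le_trans (prod_1B_expR (fun i _ => e01 i)) _.
  have eM i : escape N (iter i sig w) <= M / N%:R.
    apply: le_trans (ler_norm _) _; apply: le_trans (escape_le N (rw i)) _.
    by rewrite /M -[C2 * C3 * D / _]mulrA ler_wpM2l ?hD// mulr_ge0// (le_trans ler01).
  apply: (@le_trans _ _ (\sum_(i < k N) (M / N%:R) ^+ 2)).
    apply: ler_sum => i _; have /andP[? _] := e01 i.
    by rewrite ler_sqr// ?nnegrE ?eM// (le_trans _ (eM i)).
  rewrite sumr_const card_ord -mulr_natl le_eqVlt; apply/orP; left; apply/eqP.
  have : N%:R != 0 :> R by rewrite pnatr_eq0 -lt0n.
  by move=> ?; field.
have bk : beta (k N) @[N --> \oo] --> (0 : R) by exact: cvg_comp koo beta0.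
have qk : nuint 0 (iter (k N) sig w) (ev (Qiter N (k N) (phi 0 w)))
    @[N --> \oo] --> (0 : R).
  apply: (cvg_le_norm bk); near=> N.
  have k0 : (0 < k N)%N by near: N; move/cvgnyPge : koo; exact.
  by apply: norm_nuint_le; [exact: rw|exact: (rf_Q (rw 0%N) k0)].
have E : lamratio N (k N) w * (nuint N w (ev (phi 0 w)) +
    nuint 0 (iter (k N) sig w) (ev (Qiter N (k N) (phi 0 w)))) @[N --> \oo] -->
    expR (- I) * (1 + 0).
  by apply: cvgM => //; apply: cvgD => //; exact: cvg_nu_phi0.
rewrite addr0 mulr1 in E.
apply: cvg_trans E; apply: near_eq_cvg; near=> N.
have : (0 < k N)%N by near: N; move/cvgnyPge : koo; exact.
by rewrite mass_Xsurv//; case: (k N).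
Unshelve. all: by end_near. Qed.

End shrinking_holes.

End regular_fibers.

(** * Hitting times *)

Section hitting_time_law.
Context d (Omega : measurableType d) (R : realType).
Variables (m : probability Omega R) (X : completePseudoMetricType R).
Variable S : system_data Omega X.
Hypothesis hS : random_open_system m S.

Local Notation sig := (sd_sig S).
Local Notation sigV := (sd_sigV S).
Local Notation J := (sd_J S).
Local Notation Xsurv := (Xsurv S).
Local Notation hole := (hole S).
Local Notation Titer := (Titer S).
Local Notation mu0 := (mu0 S).
Local Notation mass := (mass S).
Local Notation escape := (escape S).

Variables (beta : nat -> R) (C2 C3 : R) (N0 : nat).
Hypothesis C3_ge1 : 1 <= C3.
Hypothesis C2_ge0 : 0 <= C2.
Hypothesis beta_ge0 : forall n, (0 < n)%N -> 0 <= beta n.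
Hypothesis beta0 : beta @ \oo --> 0.
Variables (t : Omega -> R) (xi : nat -> Omega -> R) (W : R).

Local Notation regular_fiber := (regular_fiber S beta C2 C3 N0).
Local Notation regular_orbit := (regular_orbit S beta C2 C3 N0).

Record hole_rate (w : Omega) : Prop := {
  hr_gt0 : 0 < t w ;
  hr_mu : forall N, (0 < N)%N -> mu0 w (hole N w) = ((t w + xi N w) / N%:R)%:E ;
  hr_cvg : xi N w @[N --> \oo] --> (0 : R) ;
  hr_bound : forall N, (0 < N)%N -> `|xi N w| <= W }.

Lemma mass_hole w N : regular_fiber w -> hole_rate w -> (0 < N)%N ->
  mass w (hole N w) = (t w + xi N w) / N%:R.
Proof.
move=> rw hw Ngt0; apply: EFin_inj; rewrite -(mu0E rw) ?hr_mu//.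
exact: (measurable_hole hS).
Qed.

(** The case N = 1 gives t + xi_1 <= 1, hence t <= 1 + W; the second W bounds xi_N. *)
Lemma mass_hole_le w N : regular_fiber w -> hole_rate w -> (0 < N)%N ->
  mass w (hole N w) <= (1 + W *+ 2) / N%:R.
Proof.
move=> rw hw Ngt0; rewrite mass_hole// ler_pM2r ?invr_gt0 ?ltr0n//.
have : mass w (hole 1 w) <= 1.
  rewrite -(mass_J rw); apply: (le_mass C3_ge1 rw) => //.
  - exact: (measurable_hole hS).
  - exact: (measurable_J hS).
  - exact: (hole_sub_J hS).
rewrite mass_hole// divr1 mulr2n.
have := hr_bound hw (ltnSn 0); have := hr_bound hw Ngt0; rewrite !ler_norml.
by lra.
Qed.

Lemma cvg_hole_rate w : hole_rate w -> t w + xi N w @[N --> \oo] --> t w.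
Proof.
move=> hw; rewrite -[X in _ --> X]addr0.
by apply: cvgD; [exact: cvg_cst|exact: hr_cvg].
Qed.

Lemma hole_rate_near_gt0 w : hole_rate w -> \forall N \near \oo, 0 < t w + xi N w.
Proof. by move=> hw; exact: cvgr_gt (cvg_hole_rate hw) _ (hr_gt0 hw). Qed.

(** Since t > 0, the mass is positive for large indices, and a hole of smaller index contains those
    of larger index. *)
Lemma mass_hole_gt0 w N : regular_fiber w -> hole_rate w -> (0 < N)%N ->
  0 < mass w (hole N w).
Proof.
move=> rw hw Ngt0; have [M _ HM] := hole_rate_near_gt0 hw.
pose K := maxn M N; have Kgt0 : (0 < K)%N by rewrite leq_max Ngt0 orbT.
have : 0 < mass w (hole K w).
  by rewrite mass_hole// divr_gt0 ?ltr0n//; apply: HM; exact: leq_maxl.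
move/lt_le_trans; apply; apply: (le_mass C3_ge1 rw) => //.
- exact: (measurable_hole hS).
- exact: (measurable_hole hS).
- by move=> x [_ Hx]; split => //; apply: (ros_A hS Ngt0 _ Hx); exact: leq_maxr.
- exact: (hole_sub_J hS).
Qed.

Section backward_orbit.
Variable w : Omega.
Hypothesis rw : forall k, regular_orbit (iter k sigV w).
Hypothesis hw : forall k i, hole_rate (iter i sig (iter k sigV w)).
Hypothesis cq : forall k, cvgn (fun N => qhat S N k w).

(** [cvg_truncated_series] applies to [escape_return], with survival probabilities as the factors
    tending to 1; the resulting limit of a_N / mu(H_N) is then multiplied by N mu(H_N) = t +
    xi_N. *)
Lemma cvg_escape_theta : N%:R * escape N w @[N --> \oo] --> t w * theta S w.
Proof.
have rw0 : regular_fiber w := rw 0%N 0%N.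
have hw0 : hole_rate w := hw 0%N 0%N.
have b_cvg : escape N w / mass w (hole N w) @[N --> \oo] --> theta S w.
  apply: (@cvg_truncated_series _ _
    (fun n N => mass (iter n.+1 sigV w) (Xsurv n N (iter n.+1 sigV w)))
    (fun N k => qhat S N k w) (fun n => beta n.+1) ((C2 + 1) * C3) (C2 * C3)) => //.
  - move=> n; apply: (cvg_mass_Xsurv hS C3_ge1 (rw n.+1)) => i N Ngt0.
    exact: mass_hole_le (rw n.+1 i) (hw n.+1 i) Ngt0.
  - near=> N => n; have Ngt0 : (0 < N)%N by near: N; exact: nbhs_infty_gt.
    apply: (escape_return hS) => //; last exact: mass_hole_gt0.
    by near: N; exact: nbhs_infty_ge.
  - near=> N; have Ngt0 : (0 < N)%N by near: N; exact: nbhs_infty_gt.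
    have h0 := mass_hole_gt0 rw0 hw0 Ngt0.
    rewrite normrM normfV (gtr0_norm h0) ler_pdivrMr//.
    exact: (escape_le hS C3_ge1 C2_ge0 N rw0).
  - near=> N => k; have Ngt0 : (0 < N)%N by near: N; exact: nbhs_infty_gt.
    have h0 := mass_hole_gt0 rw0 hw0 Ngt0.
    rewrite (qhatE hS C3_ge1 C2_ge0 N (rw k.+1)) divr_ge0 ?(ltW h0)//.
    by apply: (mass_ge0 C3_ge1 (rw k.+1 0%N)) => x [/(hole_sub_J hS)].
  (* One minus the partial sum, times the mass of the hole, is the mass of a first-hit set, hence
     nonnegative. *)
  - near=> N => n; have Ngt0 : (0 < N)%N by near: N; exact: nbhs_infty_gt.
    have h0 := mass_hole_gt0 rw0 hw0 Ngt0.
    have E := mass_first_hit hS C3_ge1 C2_ge0 n rw (lt0r_neq0 h0).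
    rewrite -subr_ge0 -(pmulr_rge0 _ h0) -E.
    by apply: (mass_ge0 C3_ge1 (rw n 0%N)) => x [].
  - by rewrite (cvg_shiftS beta).
have E : (t w + xi N w) * (escape N w / mass w (hole N w)) @[N --> \oo] -->
    t w * theta S w by apply: cvgM => //; exact: cvg_hole_rate.
apply: cvg_trans E; apply: near_eq_cvg; near=> N.
have Ngt0 : (0 < N)%N by near: N; exact: nbhs_infty_gt.
have h0 := mass_hole_gt0 rw0 hw0 Ngt0; move: h0; rewrite mass_hole//.
rewrite pmulr_lgt0 ?invr_gt0 ?ltr0n// => h0.
rewrite invf_div mulrCA [_ * (_ / _)]mulrCA divff ?gt_eqF// mulr1.
by rewrite mulrC.
Unshelve. all: by end_near. Qed.

End backward_orbit.

(** An integer time exceeds c / h iff it is at least the integer part of c / h plus one. Points that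
    never hit have infinite hitting time and satisfy both sides. *)
Lemma lt_hitting_time N w x (c h : R) : 0 <= c -> 0 < h -> J w x ->
  (c%:E < hitting_time S N w x * h%:E)%E <->
  forall i, (1 <= i <= Num.truncn (c / h))%N ->
    ~ hole N (iter i sig w) (Titer i w x).
Proof.
move=> c0 h0 Jx; set k := Num.truncn (c / h).
have /truncn_itv/andP[kle klt] : 0 <= c / h by rewrite divr_ge0 ?(ltW h0).
rewrite -/k in kle klt; split => [ch i /andP[i1 ik] hi|nh].
  move: ch; apply/negP; rewrite -leNgt.
  apply: (@le_trans _ _ (i%:R%:E * h%:E)%E).
    rewrite lee_wpmul2r ?lee_fin ?(ltW h0)//; apply: ereal_inf_lbound.
    by exists i.
  by rewrite -EFinM lee_fin -ler_pdivlMr// (le_trans _ kle)// ler_nat.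
apply: (@lt_le_trans _ _ (k.+1%:R%:E * h%:E)%E).
  by rewrite -EFinM lte_fin -ltr_pdivrMr.
rewrite lee_wpmul2r ?lee_fin ?(ltW h0)//; apply: le_ereal_inf_tmp.
move=> _ [i [i1 hi] <-]; rewrite lee_fin ler_nat ltnNge; apply/negP => ik.
by apply: (nh i) => //; rewrite i1.
Qed.

(** Hitting times start at 1, so avoiding the holes at times 1, ..., k means that T x survives times
    0, ..., k - 1; invariance then moves to the fibre over [sig w]. Positivity of k makes the
    predecessor genuine. *)
Lemma mass_hitting_time N w (c h : R) : regular_orbit w -> 0 <= c -> 0 < h ->
  (0 < Num.truncn (c / h))%N ->
  mu0 w [set x | J w x /\ (c%:E < hitting_time S N w x * h%:E)%E] =
  (mass (sig w) (Xsurv (Num.truncn (c / h)).-1 N (sig w)))%:E.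
Proof.
move=> rw c0 h0 k0; set k := Num.truncn _ in k0 *.
have mX := measurable_Xsurv hS k.-1 N (sig w).
rewrite -(mass_inv hS (rw 0%N) (rw 1%N) mX) -(mu0E (rw 0%N)); last first.
  exact: (measurable_Tpreimage hS).
congr (mu0 _ _); apply/seteqP; split => x [Jx].
  move/(lt_hitting_time _ c0 h0 Jx); rewrite -/k => nh; split => //.
  split => [|j jk]; first exact: (ros_T_maps hS).
  by rewrite -iterSr -TiterSr; apply: nh; rewrite /= -(prednK k0).
move=> [_ nh]; split => //; apply/(lt_hitting_time _ c0 h0 Jx) => -[//|i] /andP[_ ik].
by rewrite iterSr TiterSr; apply: nh; rewrite -ltnS (prednK k0).
Qed.

Lemma cvg_truncn_rate w : hole_rate w -> (forall N, (0 < N)%N -> 0 < t w + xi N w) ->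
  (Num.truncn (t w / ((t w + xi N w) / N%:R)))%:R / N%:R @[N --> \oo] --> (1 : R).
Proof.
move=> hw r0; have t0 := hr_gt0 hw.
have tt : t w / (t w + xi N w) @[N --> \oo] --> (1 : R).
  rewrite -(divff (lt0r_neq0 t0)); apply: cvgM; first exact: cvg_cst.
  by apply: cvgV; [exact: lt0r_neq0|exact: cvg_hole_rate].
apply: (@squeeze_cvgr _ _ _ _ (fun N => t w / (t w + xi N w) - N%:R^-1) _ _ _ _ _ tt).
  near=> N; have Ngt0 : (0 < N)%N by near: N; exact: nbhs_infty_gt.
  have N0R : 0 < N%:R :> R by rewrite ltr0n.
  have rN := r0 N Ngt0.
  have E : t w / ((t w + xi N w) / N%:R) = t w / (t w + xi N w) * N%:R.
    by rewrite invf_div mulrA mulrAC.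
  have /truncn_itv : 0 <= t w / ((t w + xi N w) / N%:R).
    by rewrite !divr_ge0 ?ltW.
  set k := Num.truncn _; rewrite E => /andP[k1 k2].
  rewrite ler_pdivrMr// k1 andbT lerBlDr.
  apply: (@le_trans _ _ (k.+1%:R / N%:R)); first by rewrite ler_pdivlMr// ltW.
  by rewrite -natr1 mulrDl mul1r.
rewrite -[X in _ --> X]subr0; apply: cvgB => //; exact: cvg_invn.
Unshelve. all: by end_near. Qed.

End hitting_time_law.

(** * Regularity of almost every two-sided orbit *)

Section almost_every_fiber.
Context d (Omega : measurableType d) (R : realType).
Variables (m : probability Omega R) (X : completePseudoMetricType R).
Variable S : system_data Omega X.
Hypothesis hS : random_open_system m S.

Lemma sigV_preserving A : measurable A -> m (sd_sigV S @^-1` A) = m A.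
Proof.
move=> mA.
have mB : measurable (sd_sigV S @^-1` A).
  by rewrite -[X in measurable X]setTI; exact: (ros_sigV_meas hS).
rewrite -(ros_preserving hS mB); congr (m _).
by apply/seteqP; split => w; rewrite /preimage /= (ros_sigK hS).
Qed.

(** The return probabilities start from fibres in the past, and the orbits leaving those fibres run
    forward. *)
Lemma ae_two_sided_orbit (P : Omega -> Prop) : (\forall w \ae m, P w) ->
  \forall w \ae m, forall k i, P (iter i (sd_sig S) (iter k (sd_sigV S) w)).
Proof.
move=> Pw.
have Pi := ae_iter_preserving (ros_sig_meas hS) (ros_preserving hS) Pw.
exact: (ae_iter_preserving (ros_sigV_meas hS) sigV_preserving Pi).
Qed.

Lemma ae_le_ess_inf_phi e (c : R) : (c%:E <= ess_inf_phi m S e)%E ->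
  \forall w \ae m, forall x, sd_J S w x -> c <= ev (sd_phi S e w) x.
Proof.
move/ess_infP; apply: filterS => w cw x Jx; rewrite -lee_fin.
by apply: le_trans cw _; apply: ereal_inf_lbound; exists x.
Qed.

Lemma ae_regular_fiber (hC2 : cond_C2 m S) (hC3 : cond_C3 m S)
    (hC4 : cond_C4' m S) (hC5 : cond_C5' m S) (hC7 : cond_C7' m S) :
  exists (beta : nat -> R) (C2 C3 : R) (N0 : nat),
    [/\ [/\ 1 <= C3, 0 <= C2 & forall n, (0 < n)%N -> 0 <= beta n],
        beta @ \oo --> 0 &
        \forall w \ae m, regular_fiber S beta C2 C3 N0 w].
Proof.
have [C2 C2_ge1 aeC5] := hC5.
have [C3 C3_ge1 [N0 _ HN0]] := hC7.
have [C [alpha [C_gt0 alpha_gt0 calpha aeC4]]] := hC4 (sd_phi S 0).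
have C2_ge0 : 0 <= C2 by rewrite (le_trans ler01).
(* The decay condition is used for the family phi_0 only, whose Banach norm is at most C2;
   summability of alpha makes this bound tend to 0. *)
exists (fun n => C * alpha n * C2), C2, C3, N0; split.
- split => // n n0; rewrite mulr_ge0// mulr_ge0 ?(ltW C_gt0)//.
  exact/ltW/alpha_gt0.
- have a0 : alpha @ \oo --> 0.
    by rewrite -(cvg_shiftS alpha); exact: cvg_series_cvg_0.
  have : C * alpha n * C2 @[n --> \oo] --> C * 0 * C2.
    by apply: cvgMl; exact: cvgMr.
  by rewrite mulr0 mul0r.
have ae_phi0 := ae_le_ess_inf_phi (HN0 N0 (leqnn _)).1.
have ae_phi : \forall w \ae m, forall N, (N0 <= N)%N ->
    forall x, sd_J S w x -> 0 <= ev (sd_phi S N w) x.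
  apply/ae_foralln => N; have [NN|NN] := leqP N0 N; last exact: aeW.
  by apply: filterS (ae_le_ess_inf_phi (HN0 N NN).2) => w pw _.
have ae_int := C2_integrable hC2 0.
have ae_eigen : \forall w \ae m, forall e,
    sd_L S e w (sd_phi S e w) = sd_lam S e w *: sd_phi S e (sd_sig S w).
  by apply/ae_foralln => e; exact: C2_eigen.
have ae_norm : \forall w \ae m, forall e, nuint S 0 w (ev (sd_phi S e w)) = 1.
  by apply/ae_foralln => e; exact: C2_norm.
have ae_C3 : \forall w \ae m, forall e (f : sd_B S w), [/\
    (sd_lam S e w)^-1 *: sd_L S e w f =
      nuint S e w (ev f) *: sd_phi S e (sd_sig S w) + sd_Q S e w f,
    sd_Q S e w (sd_phi S e w) = 0 &
    nuint S e (sd_sig S w) (ev (sd_Q S e w f)) = 0].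
  by apply/ae_foralln => e; exact: hC3.
have ae_decomp : \forall w \ae m, forall e (f : sd_B S w),
    (sd_lam S e w)^-1 *: sd_L S e w f =
      nuint S e w (ev f) *: sd_phi S e (sd_sig S w) + sd_Q S e w f.
  by apply: filterS ae_C3 => w H e f; case: (H e f).
have ae_nuQ : \forall w \ae m, forall e (f : sd_B S w),
    nuint S e (sd_sig S w) (ev (sd_Q S e w f)) = 0.
  by apply: filterS ae_C3 => w H e f; case: (H e f).
have ae_supphi : \forall w \ae m, forall e, (supnorm (sd_phi S e w) <= C2%:E)%E.
  by apply: filterS aeC5 => w [].
have ae_Q : \forall w \ae m, forall n, (0 < n)%N -> forall e,
    (supnorm (Qiter e n (sd_phi S 0 w)) <= (C * alpha n * C2)%:E)%E.
  move: aeC4 aeC5; apply: filterS2 => w Hw [_ pw] n n0 e.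
  apply: le_trans (Hw n n0 e) _; rewrite lee_fin ler_wpM2l// mulr_ge0 ?(ltW C_gt0)//.
  exact/ltW/alpha_gt0.
near=> w; split.
- by near: w; exact: (ros_nu_prob hS).
- by near: w.
- by near: w; exact: (ros_conformal_surv hS).
- by near: w.
- by near: w.
- by near: w.
- by near: w.
- by move=> e; exact: (C2_lam_gt0 hC2).
- by near: w.
- by near: w.
- by near: w.
- by near: w.
- by near: w; exact: (ros_mu_inv hS).
Unshelve. all: by end_near. Qed.

End almost_every_fiber.

(** * The exponential hitting time law *)

Theorem corollaryB (d : measure_display) (Omega : measurableType d)
    (R : realType) (m : probability Omega R)
    (X : completePseudoMetricType R) (hX : hausdorff_space X)
    (S : system_data Omega X) (t : Omega -> R)
    (hS : random_open_system m S)
    (hC1 : cond_C1' m S) (hC2 : cond_C2 m S) (hC3 : cond_C3 m S)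
    (hC4 : cond_C4' m S) (hC5 : cond_C5' m S) (hC7 : cond_C7' m S)
    (hC8 : cond_C8 m S) (hSt : cond_S m S t) :
  \forall w \ae m,
    mu0 S w [set x | sd_J S w x /\
      ((t w)%:E < hitting_time S N w x * mu0 S w (hole S N w))%E]
      @[N --> \oo]
    --> (expR (- \int[m]_v (t v * theta S v)))%:E.
Proof.
have [beta [C2 [C3 [N0 [[C3_ge1 C2_ge0 beta_ge0] beta0 ae_reg]]]]] :=
  ae_regular_fiber hS hC2 hC3 hC4 hC5 hC7.
have [_ t0 [xi [W [_ hmu hxi hW]]]] := hSt.
have ae_rate : \forall w \ae m, hole_rate S t xi W w.
  by near=> w; split; near: w.
have ae_reg2 := ae_two_sided_orbit hS ae_reg.
have ae_rate2 := ae_two_sided_orbit hS ae_rate.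
pose D := 1 + W *+ 2.
(* Truncation makes f_N bounded everywhere; by [lam_escape] it is a.e. equal to
   N * escape for large N, and it is measurable because [lam] is. *)
pose f_ N w : R := Num.max 0 (Num.min `|C2 * C3 * D|
  (N%:R * (1 - sd_lam S N w / sd_lam S 0 w))).
have mf N : measurable_fun setT (f_ N).
  apply: (@measurable_maxr _ _ _ _ (cst 0)) => //.
  apply: (@measurable_minr _ _ _ _ (cst _)) => //.
  apply: measurable_funM => //; apply: measurable_funB => //.
  apply: measurable_funM; first exact: (C2_lam_meas hC2).
  rewrite (_ : (fun x => _) = (fun x => powR x (-1)) \o sd_lam S 0).
    by apply: measurableT_comp; [exact: measurable_powR|exact: (C2_lam_meas hC2)].
  by apply/funext => x /=; rewrite powR_inv1// ltW// (C2_lam_gt0 hC2).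
have fB N w : `|f_ N w| <= `|C2 * C3 * D|.
  by rewrite ger0_norm /f_ ?le_max ?lexx// ge_max normr_ge0/= ge_min lexx.
have f_escape w : (forall k i, regular_fiber S beta C2 C3 N0
      (iter i (sd_sig S) (iter k (sd_sigV S) w))) ->
    (forall k i, hole_rate S t xi W (iter i (sd_sig S) (iter k (sd_sigV S) w))) ->
    forall N i, (0 < N)%N -> (N0 <= N)%N ->
    f_ N (iter i (sd_sig S) w) = N%:R * escape S N (iter i (sd_sig S) w).
  move=> rw hw N i Ngt0 NN; set w' := iter i _ w.
  have rw' : regular_fiber S beta C2 C3 N0 w' := rw 0%N i.
  have rw1 : regular_fiber S beta C2 C3 N0 (sd_sig S w') := rw 0%N i.+1.
  have l0 : sd_lam S 0 w' != 0 by rewrite gt_eqF// (rf_lam rw').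
  have e0 := escape_ge0 hS rw' NN.
  have N0R : 0 < N%:R :> R by rewrite ltr0n.
  have lE : sd_lam S N w' / sd_lam S 0 w' = 1 - escape S N w'.
    by rewrite (lam_escape hS N rw' rw1) mulrC mulKf.
  rewrite /f_ lE subKr.
  have eD : N%:R * escape S N w' <= `|C2 * C3 * D|.
    apply: le_trans (ler_norm _).
    have := escape_le hS C3_ge1 C2_ge0 N rw'; rewrite ger0_norm// => eh.
    rewrite mulrC -ler_pdivlMr// (le_trans eh)// -[C2 * C3 * D / _]mulrA.
    apply: ler_wpM2l; first by rewrite mulr_ge0// (le_trans ler01).
    exact: (mass_hole_le hS C3_ge1 rw' (hw 0%N i) Ngt0).
  by rewrite (min_idPr eD) max_r// mulr_ge0// ltW.
have fF : \forall w \ae m, f_ N w @[N --> \oo] --> t w * theta S w.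
  move: ae_reg2 ae_rate2 hC8; apply: filterS3 => w rw hw c8.
  (* A regular fibre with a hole rate has holes of positive measure for every N >= 1, so w lies in
     [OmegaPlus]. *)
  have c8' : forall k, cvgn (fun N => qhat S N k w).
    apply: c8 => N Ngt0; rewrite (mu0E (rw 0%N 0%N)); last exact: (measurable_hole hS).
    rewrite lte_fin; exact: (mass_hole_gt0 hS C3_ge1 (rw 0%N 0%N) (hw 0%N 0%N)).
  have E := cvg_escape_theta hS C3_ge1 C2_ge0 beta_ge0 beta0 rw hw c8'.
  apply: cvg_trans E; apply: near_eq_cvg; near=> N.
  by apply/esym/(f_escape w rw hw N 0%N); near: N;
    [exact: nbhs_infty_gt|exact: nbhs_infty_ge].
have birk := birkhoff_sum_cvg (ros_sig_meas hS) (ros_preserving hS)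
  (ros_ergodic hS) mf fB fF.
(* The averages are needed along the orbit of [sig w], where T x lives. *)
have birk1 := ae_preserving (ros_sig_meas hS) (ros_preserving hS) birk.
move: ae_reg2 ae_rate2 birk1; apply: filterS3 => w rw hw bw.
set I := \int[m]_x _ in bw *.
have rw0 := rw 0%N 0%N; have hw0 := hw 0%N 0%N.
(* The event of the theorem is avoidance of the holes at times 1, ..., k N, and k N is asymptotic to
   N. *)
pose k N := Num.truncn (t w / ((t w + xi N w) / N%:R)).
have r0 N : (0 < N)%N -> 0 < t w + xi N w.
  move=> Ngt0; have := mass_hole_gt0 hS C3_ge1 rw0 hw0 Ngt0.
  by rewrite (mass_hole hS rw0 hw0 Ngt0) pmulr_lgt0// invr_gt0 ltr0n.
have k1 : (k N)%:R / N%:R @[N --> \oo] --> (1 : R).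
  exact: (cvg_truncn_rate hw0 r0).
have sumE : \sum_(i < k N) escape S N (iter i (sd_sig S) (sd_sig S w))
    @[N --> \oo] --> I.
  apply: cvg_trans (bw k k1); apply: near_eq_cvg; near=> N.
  have Ngt0 : (0 < N)%N by near: N; exact: nbhs_infty_gt.
  have NN : (N0 <= N)%N by near: N; exact: nbhs_infty_ge.
  rewrite /birkhoff_sum mulr_sumr; apply: eq_bigr => i _.
  rewrite -iterSr (f_escape w rw hw)// mulrA mulVf ?mul1r//.
  by rewrite pnatr_eq0 -lt0n.
have rorb : regular_orbit S beta C2 C3 N0 (sd_sig S w).
  exact: (regular_orbitS (rw 0%N)).
have hD i N : (0 < N)%N ->
    mass S (iter i (sd_sig S) (sd_sig S w))
      (hole S N (iter i (sd_sig S) (sd_sig S w)))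
      <= D / N%:R.
  move=> Ngt0; rewrite -iterSr.
  exact: (mass_hole_le hS C3_ge1 (rw 0%N i.+1) (hw 0%N i.+1) Ngt0).
have lim := cvg_mass_Xsurv_diag hS C3_ge1 C2_ge0 rorb hD beta0 k1 sumE.
have limE : (mass S (sd_sig S w) (Xsurv S (k N).-1 N (sd_sig S w)))%:E
    @[N --> \oo] --> (expR (- I))%:E.
  by apply: cvg_EFin => //; exact: nearW.
apply: cvg_trans limE.
apply: near_eq_cvg; near=> N.
have Ngt0 : (0 < N)%N by near: N; exact: nbhs_infty_gt.
rewrite /= -(mass_hitting_time hS N (rw 0%N) (ltW (hr_gt0 hw0))).
- by rewrite (hr_mu hw0).
- by rewrite divr_gt0 ?ltr0n// r0.
(* k N is eventually positive because k N / N tends to 1. *)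
rewrite -[Num.truncn _]/(k N) -(ltr_nat R) -(pmulr_lgt0 _ (_ : 0 < N%:R^-1)).
  by near: N; exact: cvgr_gt k1 _ ltr01.
by rewrite invr_gt0 ltr0n.
Unshelve. all: by end_near. Qed.
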